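(* Let $C$, $D$ and $B$ be unital $C^*$-algebras. Suppose that $C$ and $D$ are strongly Morita equivalent with respect to a $C$-$D$-equivalence bimodule $Y$. Let $\{u_i\}_{i=1}^n$ be a left $C$-basis in $Y$. Let $\psi$ be a completely positive linear map from $D$ to $\mathbf{B}_B(F)$, where $F$ is a right Hilbert $B$-module. Let $\phi$ be the map from $C$ to $\mathbf{B}_B(F\otimes\mathbb{C}^n)$ defined by $$[\phi(c)_{ij}]_{i,j=1}^n=[\psi(\langle u_i, c\cdot u_j\rangle_D)]_{i,j=1}^n$$ for any $c\in C$. Then $\phi$ is a completely positive linear map from $C$ to $\mathbf{B}_B(F\otimes\mathbb{C}^n)$, which is strongly Morita equivalent to $\psi$.
   Context: For right Hilbert $B$-modules $E,F$, $\mathbf{B}_B(F,E)$ is the space of bounded adjointable right $B$-module maps $F\to E$, and $\mathbf{B}_B(E)=\mathbf{B}_B(E,E)$. $F\otimes\mathbb{C}^n$ is identified with the right Hilbert $B$-module $\bigoplus_1^n F$, and $\mathbf{B}_B(F\otimes\mathbb{C}^n)$ with $\mathbf{B}_B(F)\otimes M_n(\mathbb{C})=M_n(\mathbf{B}_B(F))$; $\phi(c)_{ij}$ is the $(i,j)$-entry. A $C$-$D$-equivalence bimodule is an imprimitivity bimodule, with left inner product ${}_C\langle\cdot,\cdot\rangle$ and right inner product $\langle\cdot,\cdot\rangle_D$ (conjugate-linear in the first variable). A finite subset $\{u_i\}_{i=1}^n$ of $Y$ is a left $C$-basis if $y=\sum_{i=1}^n {}_C\langle y,u_i\rangle\cdot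 u_i$ for all $y\in Y$. Representations $(\pi_C,E)$ of $C$ and $(\pi_D,F)$ of $D$ ($*$-homomorphisms into $\mathbf{B}_B(E)$, $\mathbf{B}_B(F)$, with $\overline{\pi_C(C)E}=E$, $\overline{\pi_D(D)F}=F$) on right Hilbert $B$-modules are strongly Morita equivalent if there exist a $C$-$D$-equivalence bimodule $Y$ and a linear map $\pi_Y:Y\to\mathbf{B}_B(F,E)$ such that for all $y,z\in Y$, $c\in C$, $d\in D$: $\pi_Y(y)\pi_Y(z)^*=\pi_C({}_C\langle y,z\rangle)$; $\pi_Y(y)^*\pi_Y(z)=\pi_D(\langle y,z\rangle_D)$; $\pi_Y(c\cdot y\cdot d)=\pi_C(c)\pi_Y(y)\pi_D(d)$. For a completely positive linear map $\psi:D\to\mathbf{B}_B(F)$, a minimal KSGNS-representation is a triple $(\pi_\psi,V_\psi,F_\psi)$ with $F_\psi$ a right Hilbert $B$-module, $\pi_\psi$ a representation of $D$ on $F_\psi$, $V_\psi\in\mathbf{B}_B(F,F_\psi)$, $\psi(d)=V_\psi^*\pi_\psi(d)V_\psi$ for all $d\in D$, and $\overline{\pi_\psi(D)V_\psi F}=F_\psi$ (it exists and is unique up to unitary equivalence). Completely positive linear maps $C\to\mathbf{B}_B(E)$ and $D\to\mathbf{B}_B(F)$ are strongly Morita equivalent if a minimal KSGNS-representation for the first is strongly Morita equivalent to a minimal KSGNS-representation for the second. *)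

(* Defs.v *)
From HB Require Import structures.
From mathcomp Require Import all_boot all_order all_algebra complex.
From mathcomp Require Import all_classical all_reals.

Set Implicit Arguments.
Unset Strict Implicit.
Unset Printing Implicit Defensive.

Import Order.TTheory GRing.Theory Num.Theory.

Local Open Scope classical_set_scope.
Local Open Scope ring_scope.

(** * Rings with involution, positive elements *)

(* Possibly zero rings are allowed: 'B(F) below is the zero ring if F = 0. *)
HB.mixin Record PzRing_isStarRing S of GRing.PzRing S := {
  star : S -> S;
  starK : involutive star;
  starD : {morph star : x y / x + y};
  starM : forall x y, star (x * y) = star y * star x }.

#[short(type="starRingType")]
HB.structure Definition StarRing := {S of GRing.PzRing S & PzRing_isStarRing S}.

Definition positive (S : starRingType) (a : S) : Prop :=
  exists b : S, a = star b * b.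

Section MatrixStar.
Variables (S : starRingType) (n : nat).
Implicit Types A B : 'M[S]_n.

Definition mxstar A : 'M[S]_n := \matrix_(i, j) star (A j i).

Fact mxstarK : involutive mxstar.
Proof. by move=> A; apply/matrixP => i j; rewrite !mxE starK. Qed.

Fact mxstarD : {morph mxstar : A B / A + B}.
Proof. by move=> A B; apply/matrixP => i j; rewrite !mxE starD. Qed.

Fact star0 : star (0 : S) = 0.
Proof. by apply: (addrI (star (0 : S))); rewrite -starD !addr0. Qed.

Fact mxstarM A B : mxstar (A * B) = mxstar B * mxstar A.
Proof.
apply/matrixP => i j; rewrite !mxE (big_morph _ (@starD S) star0).
by apply: eq_bigr => k _; rewrite !mxE starM.
Qed.

HB.instance Definition _ :=
  PzRing_isStarRing.Build 'M[S]_n mxstarK mxstarD mxstarM.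
End MatrixStar.

(** * Unital C*-algebras *)

Definition seq_complete (R : realType) (V : zmodType) (norm : V -> R) : Prop :=
  forall x : nat -> V,
    (forall e : R, 0 < e -> exists N, forall p q,
        (N <= p)%N -> (N <= q)%N -> norm (x p - x q) < e) ->
    exists l : V, forall e : R, 0 < e -> exists N, forall p,
        (N <= p)%N -> norm (x p - l) < e.

(* The complex algebra structure is given by the unit map k |-> k 1. MathComp's
   algType would exclude the zero algebra, and its hierarchy has no room for a
   structure that is both a possibly zero ring and a module or a normed group. *)
HB.mixin Record isCStarAlgebra (R : realType) A of StarRing A := {
  cunit : {rmorphism R[i] -> A};
  cunitC : forall k (a : A), cunit k * a = a * cunit k;
  star_cunit : forall k, star (cunit k) = cunit (Num.conj k);
  cnorm : A -> R;
  cnorm_eq0 : forall a : A, cnorm a = 0 -> a = 0;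
  cnormD : forall a b : A, cnorm (a + b) <= cnorm a + cnorm b;
  cnormZ : forall k (a : A), cnorm (cunit k * a) = Normc.normc k * cnorm a;
  cnormM : forall a b : A, cnorm (a * b) <= cnorm a * cnorm b;
  cnorm_star : forall a : A, cnorm (star a * a) = cnorm a ^+ 2;
  cnorm_complete : seq_complete cnorm }.

#[short(type="cstarAlgType")]
HB.structure Definition CStarAlgebra (R : realType) :=
  {A of StarRing A & isCStarAlgebra R A}.

Definition cscale (R : realType) (A : cstarAlgType R) (k : R[i]) (a : A) : A :=
  cunit k * a.

Section CScale.
Variables (R : realType) (A : cstarAlgType R).
Implicit Types (k : R[i]) (a : A).

Fact cscale0 a : cscale 0 a = 0.
Proof. by rewrite /cscale rmorph0 mul0r. Qed.

Fact cscaleN1 a : cscale (-1) a = - a.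
Proof. by rewrite /cscale rmorphN rmorph1 mulN1r. Qed.

Fact cscaleAl k a b : cscale k a * b = cscale k (a * b).
Proof. by rewrite /cscale mulrA. Qed.

Fact cscale_sumr k I (r : seq I) (P : pred I) (f : I -> A) :
  cscale k (\sum_(i <- r | P i) f i) = \sum_(i <- r | P i) cscale k (f i).
Proof. exact: mulr_sumr. Qed.

Fact starZ k a : star (cscale k a) = cscale (Num.conj k) (star a).
Proof. by rewrite /cscale starM star_cunit cunitC. Qed.
End CScale.

(* Complex linearity of a map from a C*-algebra to a complex vector space *)
Definition clinear (R : realType) (A : cstarAlgType R) (V : lmodType R[i])
    (f : A -> V) : Prop :=
  forall (k : R[i]) (a b : A), f (cscale k a + b) = k *: f a + f b.

(** * Algebra-valued forms and their norms *)

Section Forms.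
Variables (R : realType) (A : cstarAlgType R) (V : lmodType R[i]).
Variable form : V -> V -> A.

Definition form_norm (x : V) : R := Num.sqrt (cnorm (form x x)).

Definition hilbert_form : Prop :=
  [/\ forall x, positive (form x x),
      forall x, form x x = 0 -> x = 0 &
      seq_complete form_norm].

End Forms.

(* The linear span of S is norm-dense. *)
Definition dense_span (R : realType) (V : zmodType) (scale : R[i] -> V -> V)
    (norm : V -> R) (S : set V) : Prop :=
  forall (x : V) (e : R), 0 < e ->
    exists m (k : 'I_m -> R[i]) (s : 'I_m -> V),
      (forall i, S (s i)) /\ norm (x - \sum_i scale (k i) (s i)) < e.

Definition full_form (R : realType) (A : cstarAlgType R) (V : lmodType R[i])
    (form : V -> V -> A) : Prop :=
  dense_span (@cscale R A) (@cnorm R A)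
    [set form p.1 p.2 | p in [set: V * V]].

(** * Right Hilbert modules *)

(* The algebraic part of the definition of a right Hilbert B-module; the
   analytic part (positivity, definiteness, completeness) is [hilbert]. *)
HB.mixin Record isInnerModule (R : realType) (B : cstarAlgType R) E
    of GRing.Lmodule R[i] E := {
  ract : E -> B -> E;
  ractDl : forall x y b, ract (x + y) b = ract x b + ract y b;
  ractDr : forall x b c, ract x (b + c) = ract x b + ract x c;
  ractZl : forall (k : R[i]) x b, ract (k *: x) b = k *: ract x b;
  ractZr : forall (k : R[i]) x b, ract x (cscale k b) = k *: ract x b;
  ractA : forall x b c, ract x (b * c) = ract (ract x b) c;
  ract1 : forall x, ract x 1 = x;
  rin : E -> E -> B;
  rinDr : forall x y z, rin x (y + z) = rin x y + rin x z;
  rinZr : forall (k : R[i]) x y, rin x (k *: y) = cscale k (rin x y);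
  rinA : forall x y b, rin x (ract y b) = rin x y * b;
  rinC : forall x y, star (rin x y) = rin y x }.

#[short(type="innerModType")]
HB.structure Definition InnerModule (R : realType) (B : cstarAlgType R) :=
  {E of GRing.Lmodule R[i] E & isInnerModule R B E}.

Definition hilbert (R : realType) (B : cstarAlgType R) (E : innerModType B) :=
  hilbert_form (@rin R B E).

Definition hnorm (R : realType) (B : cstarAlgType R) (E : innerModType B) :=
  form_norm (@rin R B E).

Section FormLemmas.
Variables (R : realType) (B : cstarAlgType R) (E : innerModType B).
Implicit Types x y z : E.

Fact rinDl x y z : rin (x + y) z = rin x z + rin y z :> B.
Proof. by rewrite -(rinC z) rinDr starD !rinC. Qed.

Fact rinZl k x y : rin (k *: x) y = cscale (Num.conj k) (rin x y : B).
Proof. by rewrite -(rinC y) rinZr starZ rinC. Qed.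

Fact rin0r x : rin x 0 = 0 :> B.
Proof. by rewrite -(scale0r 0) rinZr cscale0. Qed.

Fact rin0l x : rin 0 x = 0 :> B.
Proof. by rewrite -(rinC x) rin0r star0. Qed.

Fact rinNr x y : rin x (- y) = - rin x y :> B.
Proof. by rewrite -scaleN1r rinZr cscaleN1. Qed.

Fact rinNl x y : rin (- x) y = - rin x y :> B.
Proof. by apply/eqP; rewrite -addr_eq0 -rinDl addNr rin0l. Qed.

Fact rin_sumr x I (r : seq I) (P : pred I) (f : I -> E) :
  rin x (\sum_(i <- r | P i) f i) = \sum_(i <- r | P i) rin x (f i) :> B.
Proof. exact: (big_morph _ (rinDr x) (rin0r x)). Qed.

Fact rin_suml x I (r : seq I) (P : pred I) (f : I -> E) :
  rin (\sum_(i <- r | P i) f i) x = \sum_(i <- r | P i) rin (f i) x :> B.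
Proof. exact: (big_morph (rin^~ x) (fun y z => rinDl y z x) (rin0l x)). Qed.

Fact ract0l (b : B) : ract (0 : E) b = 0.
Proof. by have := ractZl 0 (0 : E) b; rewrite !scale0r. Qed.

Fact ractNl x (b : B) : ract (- x) b = - ract x b.
Proof. by rewrite -scaleN1r ractZl scaleN1r. Qed.
End FormLemmas.

(** * The direct sum of n copies of F, identified with F (x) C^n *)

Section DirectSum.
Variables (R : realType) (B : cstarAlgType R) (F : innerModType B) (n : nat).
Implicit Types x y z : {ffun 'I_n -> F}.

Definition dsum_ract x (b : B) : {ffun 'I_n -> F} := [ffun i => ract (x i) b].
Definition dsum_rin x y : B := \sum_i rin (x i) (y i).

Fact dsum_ractDl x y b : dsum_ract (x + y) b = dsum_ract x b + dsum_ract y b.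
Proof. by apply/ffunP => i; rewrite !ffunE ractDl. Qed.
Fact dsum_ractDr x b c : dsum_ract x (b + c) = dsum_ract x b + dsum_ract x c.
Proof. by apply/ffunP => i; rewrite !ffunE ractDr. Qed.
Fact dsum_ractZl (k : R[i]) x b : dsum_ract (k *: x) b = k *: dsum_ract x b.
Proof. by apply/ffunP => i; rewrite !ffunE ractZl. Qed.
Fact dsum_ractZr (k : R[i]) x b : dsum_ract x (cscale k b) = k *: dsum_ract x b.
Proof. by apply/ffunP => i; rewrite !ffunE ractZr. Qed.
Fact dsum_ractA x b c : dsum_ract x (b * c) = dsum_ract (dsum_ract x b) c.
Proof. by apply/ffunP => i; rewrite !ffunE ractA. Qed.
Fact dsum_ract1 x : dsum_ract x 1 = x.
Proof. by apply/ffunP => i; rewrite !ffunE ract1. Qed.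
Fact dsum_rinDr x y z : dsum_rin x (y + z) = dsum_rin x y + dsum_rin x z.
Proof. by rewrite /dsum_rin -big_split; apply: eq_bigr => i _; rewrite ffunE rinDr. Qed.
Fact dsum_rinZr (k : R[i]) x y : dsum_rin x (k *: y) = cscale k (dsum_rin x y).
Proof. by rewrite /dsum_rin cscale_sumr; apply: eq_bigr => i _; rewrite ffunE rinZr. Qed.
Fact dsum_rinA x y b : dsum_rin x (dsum_ract y b) = dsum_rin x y * b.
Proof. by rewrite /dsum_rin mulr_suml; apply: eq_bigr => i _; rewrite ffunE rinA. Qed.
Fact dsum_rinC x y : star (dsum_rin x y) = dsum_rin y x.
Proof.
rewrite /dsum_rin (big_morph _ (@starD B) (star0 B)).
by apply: eq_bigr => i _; rewrite rinC.
Qed.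

HB.instance Definition _ := isInnerModule.Build R B {ffun 'I_n -> F}
  dsum_ractDl dsum_ractDr dsum_ractZl dsum_ractZr dsum_ractA dsum_ract1
  dsum_rinDr dsum_rinZr dsum_rinA dsum_rinC.
End DirectSum.

(** * Adjointable module maps *)

Section ModuleMap.
Variables (R : realType) (B : cstarAlgType R).

Definition module_map (F E : innerModType B) (f : F -> E) : Prop :=
  linear f /\ forall x (b : B), f (ract x b) = ract (f x) b.

(* Between Hilbert modules the adjoint is unique and automatically a module map,
   so recording it as data adds nothing. The space B_B(F,E) consists of the
   adjmap's satisfying [bounded_map]; between Hilbert modules every adjmap is
   bounded, by the uniform boundedness principle. *)
Record adjmap (F E : innerModType B) := Adjmap {
  adjmap_fun :> F -> E;
  adjmap_adj : E -> F;
  adjmap_mod : module_map adjmap_fun;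
  adjmap_adj_mod : module_map adjmap_adj;
  adjmapE : forall x y, rin (adjmap_fun x) y = rin x (adjmap_adj y) :> B }.

Definition bounded_map (F E : innerModType B) (T : adjmap F E) : Prop :=
  exists M : R, forall x, hnorm (T x) <= M * hnorm x.

Lemma adjmap_ext (F E : innerModType B) (S T : adjmap F E) :
  S =1 T -> adjmap_adj S =1 adjmap_adj T -> S = T.
Proof.
case: S T => [s s' sm sm' sE] [t t' tm tm' tE] /= /funext st /funext st'.
subst t t'.
by rewrite (Prop_irrelevance sm tm) (Prop_irrelevance sm' tm')
  (Prop_irrelevance sE tE).
Qed.

Section Operations.
Variables F E G : innerModType B.
Implicit Types (S T : adjmap F E).

Fact module_map0 : module_map (fun _ : F => 0 : E).
Proof.
by split=> [k x y|x b]; [rewrite scaler0 addr0 | rewrite ract0l].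
Qed.

Fact module_mapD (f g : F -> E) :
  module_map f -> module_map g -> module_map (f \+ g).
Proof.
move=> [fl fm] [gl gm]; split=> [k x y|x b] /=.
  by rewrite fl gl scalerDr addrACA.
by rewrite fm gm ractDl.
Qed.

Fact module_mapZ (k : R[i]) (f : F -> E) :
  module_map f -> module_map (fun x => k *: f x).
Proof.
move=> [fl fm]; split=> [h x y|x b].
  by rewrite fl scalerDr !scalerA mulrC.
by rewrite fm ractZl.
Qed.

Fact module_map_comp (f : E -> G) (g : F -> E) :
  module_map f -> module_map g -> module_map (f \o g).
Proof.
move=> [fl fm] [gl gm]; split=> [k x y|x b] /=; first by rewrite gl fl.
by rewrite gm fm.
Qed.

Fact module_map_id : module_map (@id F).
Proof. by []. Qed.
End Operations.

Definition adjmap_star (F E : innerModType B) (T : adjmap F E) : adjmap E F.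
Proof.
refine (Adjmap (adjmap_adj_mod T) (adjmap_mod T) _) => x y.
by rewrite -rinC -adjmapE rinC.
Defined.

Definition adjmap_comp (F E G : innerModType B)
  (S : adjmap E G) (T : adjmap F E) : adjmap F G.
Proof.
refine (Adjmap (module_map_comp (adjmap_mod S) (adjmap_mod T))
  (module_map_comp (adjmap_adj_mod T) (adjmap_adj_mod S)) _) => x y /=.
by rewrite !adjmapE.
Defined.

Section LinearStructure.
Variables F E : innerModType B.
Implicit Types (S T U : adjmap F E).

Definition adjmap0 : adjmap F E.
Proof.
refine (Adjmap (module_map0 F E) (module_map0 E F) _) => x y.
by rewrite rin0l rin0r.
Defined.

Definition adjmap_add S T : adjmap F E.
Proof.
refine (Adjmap (module_mapD (adjmap_mod S) (adjmap_mod T))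
  (module_mapD (adjmap_adj_mod S) (adjmap_adj_mod T)) _) => x y /=.
by rewrite rinDl rinDr !adjmapE.
Defined.

Definition adjmap_scale (k : R[i]) T : adjmap F E.
Proof.
refine (Adjmap (module_mapZ k (adjmap_mod T))
  (module_mapZ (Num.conj k) (adjmap_adj_mod T)) _) => x y /=.
by rewrite rinZl rinZr adjmapE.
Defined.

Definition adjmap_opp T : adjmap F E := adjmap_scale (-1) T.

HB.instance Definition _ := gen_eqMixin (adjmap F E).
HB.instance Definition _ := gen_choiceMixin (adjmap F E).

Fact adjmap_addA : associative adjmap_add.
Proof. by move=> S T U; apply: adjmap_ext => x /=; rewrite addrA. Qed.
Fact adjmap_addC : commutative adjmap_add.
Proof. by move=> S T; apply: adjmap_ext => x /=; rewrite addrC. Qed.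
Fact adjmap_add0 : left_id adjmap0 adjmap_add.
Proof. by move=> S; apply: adjmap_ext => x /=; rewrite add0r. Qed.
Fact adjmap_addN : left_inverse adjmap0 adjmap_opp adjmap_add.
Proof.
move=> S; apply: adjmap_ext => x /=; last rewrite rmorphN rmorph1.
  by rewrite scaleN1r addNr.
by rewrite scaleN1r addNr.
Qed.

HB.instance Definition _ := GRing.isZmodule.Build (adjmap F E)
  adjmap_addA adjmap_addC adjmap_add0 adjmap_addN.

Fact adjmap_scaleA k h T :
  adjmap_scale k (adjmap_scale h T) = adjmap_scale (k * h) T.
Proof. by apply: adjmap_ext => x /=; rewrite ?rmorphM scalerA. Qed.
Fact adjmap_scale1 : left_id 1 adjmap_scale.
Proof. by move=> T; apply: adjmap_ext => x /=; rewrite ?rmorph1 scale1r. Qed.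
Fact adjmap_scaleDr : right_distributive adjmap_scale +%R.
Proof. by move=> k S T; apply: adjmap_ext => x /=; rewrite scalerDr. Qed.
Fact adjmap_scaleDl T : {morph adjmap_scale^~ T : k h / k + h}.
Proof.
by move=> k h; apply: adjmap_ext => x /=; rewrite ?rmorphD scalerDl.
Qed.

HB.instance Definition _ := GRing.Zmodule_isLmodule.Build R[i] (adjmap F E)
  adjmap_scaleA adjmap_scale1 adjmap_scaleDr adjmap_scaleDl.
End LinearStructure.

Section RingStructure.
Variable F : innerModType B.
Implicit Types (S T U : adjmap F F).

Definition adjmap1 : adjmap F F :=
  @Adjmap F F id id (module_map_id F) (module_map_id F) (fun _ _ => erefl).

Fact module_map_funD (E : innerModType B) (f : F -> E) :
  module_map f -> {morph f : x y / x + y}.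
Proof. by move=> [fl _] x y; rewrite -[x]scale1r fl !scale1r. Qed.

Fact adjmap_compA : associative (@adjmap_comp F F F).
Proof. by move=> S T U; apply: adjmap_ext. Qed.
Fact adjmap_comp1l : left_id adjmap1 (@adjmap_comp F F F).
Proof. by move=> S; apply: adjmap_ext. Qed.
Fact adjmap_comp1r : right_id adjmap1 (@adjmap_comp F F F).
Proof. by move=> S; apply: adjmap_ext. Qed.
Fact adjmap_compDl : left_distributive (@adjmap_comp F F F) +%R.
Proof.
move=> S T U; apply: adjmap_ext => x //=.
exact: (module_map_funD (adjmap_adj_mod U)).
Qed.
Fact adjmap_compDr : right_distributive (@adjmap_comp F F F) +%R.
Proof.
move=> S T U; apply: adjmap_ext => x //=.
exact: (module_map_funD (adjmap_mod S)).
Qed.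

HB.instance Definition _ := GRing.Zmodule_isPzRing.Build (adjmap F F)
  adjmap_compA adjmap_comp1l adjmap_comp1r adjmap_compDl adjmap_compDr.

Fact adjmap_starK : involutive (@adjmap_star F F).
Proof. by move=> S; apply: adjmap_ext. Qed.
Fact adjmap_starD : {morph @adjmap_star F F : S T / S + T}.
Proof. by move=> S T; apply: adjmap_ext. Qed.
Fact adjmap_starM S T :
  adjmap_star (S * T) = adjmap_star T * adjmap_star S.
Proof. by apply: adjmap_ext. Qed.

HB.instance Definition _ := PzRing_isStarRing.Build (adjmap F F)
  adjmap_starK adjmap_starD adjmap_starM.
End RingStructure.

(* The operator on the direct sum of n copies of F given by an n x n matrix of
   operators on F: (T x)_i = \sum_j T_ij x_j. *)
Section MatrixOperator.
Variables (F : innerModType B) (n : nat).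

Definition mxact (T : 'I_n -> 'I_n -> F -> F) (x : {ffun 'I_n -> F}) :
  {ffun 'I_n -> F} := [ffun i => \sum_j T i j (x j)].

Fact module_map_mxact T : (forall i j, module_map (T i j)) ->
  module_map (mxact T).
Proof.
move=> Tm; split=> [k x y|x b]; apply/ffunP => i; rewrite !ffunE.
  rewrite scaler_sumr -big_split; apply: eq_bigr => j _ /=.
  by have [Tl _] := Tm i j; rewrite !ffunE Tl.
rewrite (big_morph (ract^~ b) (fun y z => ractDl y z b) (ract0l F b)).
by apply: eq_bigr => j _; have [_ Tr] := Tm i j; rewrite ffunE Tr.
Qed.

Definition adjmap_of_mx (T : 'M[adjmap F F]_n) :
  adjmap {ffun 'I_n -> F} {ffun 'I_n -> F}.
Proof.
refine (@Adjmap {ffun 'I_n -> F} {ffun 'I_n -> F}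
  (mxact (fun i j => T i j)) (mxact (fun i j => adjmap_adj (T j i)))
  (module_map_mxact (fun i j => adjmap_mod (T i j)))
  (module_map_mxact (fun i j => adjmap_adj_mod (T j i))) _) => x y.
rewrite /rin /= /dsum_rin; under eq_bigr do rewrite ffunE rin_suml.
rewrite exchange_big; apply: eq_bigr => j _ /=.
by rewrite ffunE rin_sumr; apply: eq_bigr => i _; rewrite adjmapE.
Defined.
End MatrixOperator.
End ModuleMap.

(** * Equivalence (imprimitivity) bimodules *)

(* Y is a full right Hilbert D-module and a full left Hilbert C-module with
   commuting actions, each acting adjointably for the form valued in the other
   algebra, and C<x,y> z = x <y,z>_D. *)
HB.mixin Record isEquivBimodule (R : realType) (C D : cstarAlgType R) Y
    of InnerModule R D Y := {
  rin_hilbert : hilbert Y;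
  rin_full : full_form (rin : Y -> Y -> D);
  lact : C -> Y -> Y;
  lactDl : forall c c' y, lact (c + c') y = lact c y + lact c' y;
  lactDr : forall c y z, lact c (y + z) = lact c y + lact c z;
  lactZl : forall (k : R[i]) c y, lact (cscale k c) y = k *: lact c y;
  lactZr : forall (k : R[i]) c y, lact c (k *: y) = k *: lact c y;
  lactA : forall c c' y, lact (c * c') y = lact c (lact c' y);
  lact1 : forall y, lact 1 y = y;
  lin : Y -> Y -> C;
  linDl : forall x y z, lin (x + y) z = lin x z + lin y z;
  linZl : forall (k : R[i]) x y, lin (k *: x) y = cscale k (lin x y);
  linA : forall c x y, lin (lact c x) y = c * lin x y;
  linC : forall x y, star (lin x y) = lin y x;
  lin_hilbert : hilbert_form lin;
  lin_full : full_form lin;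
  lact_ract : forall c y (d : D), ract (lact c y) d = lact c (ract y d);
  rin_lact : forall c x y, rin (lact c x) y = rin x (lact (star c) y) :> D;
  lin_ract : forall x y (d : D), lin (ract x d) y = lin x (ract y (star d));
  lin_rin : forall x y z, lact (lin x y) z = ract x (rin y z : D) }.

#[short(type="equivBimodType")]
HB.structure Definition EquivBimodule (R : realType) (C D : cstarAlgType R) :=
  {Y of InnerModule R D Y & isEquivBimodule R C D Y}.

Definition left_basis (R : realType) (C D : cstarAlgType R)
    (Y : equivBimodType C D) (n : nat) (u : 'I_n -> Y) : Prop :=
  forall y : Y, y = \sum_i lact (lin y (u i) : C) (u i).

(** * Representations, completely positive maps, strong Morita equivalence *)

Section Representations.
Variables (R : realType) (B : cstarAlgType R).

Record representation (A : cstarAlgType R) (E : innerModType B)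
    (pi : A -> adjmap E E) : Prop := Representation {
  rep_hilbert : hilbert E;
  rep_bounded : forall a, bounded_map (pi a);
  rep_linear : clinear pi;
  repM : forall a b, pi (a * b) = pi a * pi b;
  rep_star : forall a, pi (star a) = star (pi a);
  rep_nondegenerate :
    dense_span *:%R (@hnorm R B E) [set pi p.1 p.2 | p in [set: A * E]] }.

Definition rep_morita_equiv (C D : cstarAlgType R) (E F : innerModType B)
    (piC : C -> adjmap E E) (piD : D -> adjmap F F) : Prop :=
  exists (Y : equivBimodType C D) (piY : Y -> adjmap F E),
    [/\ linear piY, forall y, bounded_map (piY y),
        forall y z, adjmap_comp (piY y) (adjmap_star (piY z)) = piC (lin y z),
        forall y z, adjmap_comp (adjmap_star (piY y)) (piY z) = piD (rin y z) &
        forall (c : C) y (d : D), piY (ract (lact c y) d)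
          = adjmap_comp (piC c) (adjmap_comp (piY y) (piD d))].

Record cp_map (A : cstarAlgType R) (E : innerModType B)
    (phi : A -> adjmap E E) : Prop := CPMap {
  cp_bounded : forall a, bounded_map (phi a);
  cp_linear : clinear phi;
  cp_positive : forall m (a : 'M[A]_m), positive a -> positive (map_mx phi a) }.

Record minimal_KSGNS (A : cstarAlgType R) (F : innerModType B)
    (psi : A -> adjmap F F) (G : innerModType B) (pi : A -> adjmap G G)
    (V : adjmap F G) : Prop := MinimalKSGNS {
  ksgns_rep : representation pi;
  ksgns_bounded : bounded_map V;
  ksgnsE : forall a,
    psi a = adjmap_comp (adjmap_star V) (adjmap_comp (pi a) V);
  ksgns_minimal :
    dense_span *:%R (@hnorm R B G) [set pi p.1 (V p.2) | p in [set: A * F]] }.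

Definition cp_morita_equiv (C D : cstarAlgType R) (E F : innerModType B)
    (phi : C -> adjmap E E) (psi : D -> adjmap F F) : Prop :=
  exists (G : innerModType B) (piC : C -> adjmap G G) (V : adjmap E G)
         (H : innerModType B) (piD : D -> adjmap H H) (W : adjmap F H),
    [/\ minimal_KSGNS phi piC V, minimal_KSGNS psi piD W &
        rep_morita_equiv piC piD].
End Representations.

(* Main.v *)
(* A minimal KSGNS representation (pi, W) of psi on H is a Hilbert module of functions
   D -> F with reproducing kernel psi(d^* d'). Fullness of the left inner product
   yields a right basis v of Y, so that Y (x)_D H is the range of the projection
   [pi <v_i, v_j>] on a direct sum of copies of H. It carries a representation of C
   that is strongly Morita equivalent to pi through rho(y) h = y (x) h, and
   V (x_j)_j = sum_j u_j (x) W x_j makes it a KSGNS representation of phi; it is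
   minimal because y (x) W x = sum_i C<y, u_i> V (x placed at i) by the left basis
   property. Complete positivity of phi follows from that of psi since the matrices
   [<u_k, a_ij u_l>] with a positive are sums of Gram matrices over D.
   Underneath all this is the theorem of Kelley and Vaught, that the elements b^* b of
   a C*-algebra form a closed convex cone; it is proved here without spectral theory,
   from square roots obtained by iteration. *)
Require Import Defs.
From HB Require Import structures.
From mathcomp Require Import all_boot all_order all_algebra complex.
From mathcomp Require Import all_classical all_reals.
From mathcomp Require Import ring lra.

Set Implicit Arguments.
Unset Strict Implicit.
Unset Printing Implicit Defensive.

Import Order.TTheory GRing.Theory Num.Theory.

Local Open Scope ring_scope.

(** * Square roots and positivity in C*-algebras *)

Section RealSequences.
Variable R : realType.
Implicit Types (q : nat -> R) (e : R).

(** No quotient and no completion is formed. Elements of the KSGNS module are actual functions on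
    [D], and evaluation at each point is continuous, so definiteness and limits come pointwise from
    [F]. The tensor product is the set of fixed points of a bounded operator on a finite direct sum,
    hence closed. The cost lies in positivity: [positive] asks for a single factor [b], so even the
    inner product on a direct sum requires a sum of elements [star b * b] to be again of this form.
    Operators raise the same question: complete positivity of [phi] adds up positive matrices over
    [adjmap F F], and one factor for the sum is found only once the bounded operators on a Hilbert
    module are known to be a C*-algebra. The right basis supplies both the coordinates of the tensor
    product and an explicit finite formula for the action of [C], so adjointability and boundedness
    of that action need no extension by continuity. *)

Lemma nondecreasing_bounded_cauchy q M : (forall n, q n <= q n.+1) ->
  (forall n, q n <= M) -> forall e, 0 < e ->
  exists N, forall m n, (N <= m)%N -> (N <= n)%N -> `|q m - q n| < e.
Proof.
move=> q_incr q_le e e_gt0.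
have q_homo m n : (m <= n)%N -> q m <= q n.
  by elim: n => [|n IH]; rewrite leq_eqVlt => /orP[/eqP->//|//] /IH /le_trans; apply.
pose E := [set q n | n in [set: nat]]%classic.
have supE : has_sup E.
  by split; [exists (q 0%N), 0%N | exists M => _ [n _ <-]].
have [_ [N _ <-] Ngt] := sup_adherent e_gt0 supE.
have Eub n : q n <= sup E by apply: (sup_upper_bound supE); exists n.
exists N => m n /q_homo Nm /q_homo Nn; have := Eub m; have := Eub n => um un.
by rewrite ltr_norml; apply/andP; split; lra.
Qed.

Lemma inv_nat_small M e : 0 <= M -> 0 < e ->
  exists N, forall n, (N <= n)%N -> M * n.+1%:R^-1 < e.
Proof.
move=> M_ge0 e_gt0; have /archi_boundP : 0 <= M / e by rewrite divr_ge0 // ltW.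
set N := Num.bound _ => MN; exists N => n Nn.
rewrite ltr_pdivrMr // mulrC -ltr_pdivrMr //; apply: lt_le_trans MN _.
by rewrite ler_nat leqW.
Qed.
End RealSequences.

Definition converges (R : realType) (V : zmodType) (norm : V -> R)
    (x : nat -> V) (l : V) : Prop :=
  forall e : R, 0 < e -> exists N, forall p, (N <= p)%N -> norm (x p - l) < e.

Section StarRing.
Variable S : starRingType.
Implicit Types a b : S.

Lemma starN a : star (- a) = - star a.
Proof. by apply/eqP; rewrite -addr_eq0 -starD addNr star0. Qed.
Lemma starB a b : star (a - b) = star a - star b.
Proof. by rewrite starD starN. Qed.
Lemma star1 : star 1 = 1 :> S.
Proof. by rewrite -[LHS]mulr1 -{2}[1]starK -starM mulr1 starK. Qed.
Lemma star_sum I (r : seq I) (f : I -> S) :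
  star (\sum_(i <- r) f i) = \sum_(i <- r) star (f i).
Proof. exact: (big_morph _ (@starD S) (star0 S)). Qed.

End StarRing.

Section CStarAlgebra.
Variables (R : realType) (A : cstarAlgType R).
Implicit Types (a b c d h : A) (r s t : R).

Definition creal r : A := cunit (r%:C)%C.

Lemma crealD r s : creal (r + s) = creal r + creal s.
Proof. by rewrite /creal !rmorphD. Qed.
Lemma crealN r : creal (- r) = - creal r.
Proof. by rewrite /creal !rmorphN. Qed.
Lemma crealB r s : creal (r - s) = creal r - creal s.
Proof. by rewrite crealD crealN. Qed.
Lemma crealM r s : creal (r * s) = creal r * creal s.
Proof. by rewrite /creal !rmorphM. Qed.
Lemma creal0 : creal 0 = 0.
Proof. by rewrite /creal !rmorph0. Qed.
Lemma creal1 : creal 1 = 1.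
Proof. by rewrite /creal !rmorph1. Qed.
Lemma crealC r a : creal r * a = a * creal r.
Proof. exact: cunitC. Qed.
Lemma star_creal r : star (creal r) = creal r.
Proof. by rewrite /creal star_cunit (conjc_real r : Num.conj _ = _). Qed.

Lemma cnormMreal r a : cnorm (creal r * a) = `|r| * cnorm a.
Proof. by rewrite cnormZ /= expr0n /= addr0 sqrtr_sqr. Qed.
Lemma cnormN a : cnorm (- a) = cnorm a.
Proof. by rewrite -mulN1r -creal1 -crealN cnormMreal normrN1 mul1r. Qed.
Lemma cnorm0 : cnorm (0 : A) = 0.
Proof. by rewrite -(mul0r (0 : A)) -creal0 cnormMreal normr0 mul0r. Qed.
Lemma cnorm_ge0 a : 0 <= cnorm a.
Proof. by have := cnormD a (- a); rewrite subrr cnorm0 cnormN; lra. Qed.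
Lemma cdistC a b : cnorm (a - b) = cnorm (b - a).
Proof. by rewrite -cnormN opprB. Qed.
Lemma cnormB a b : cnorm (a - b) <= cnorm a + cnorm b.
Proof. by rewrite -(cnormN b) cnormD. Qed.
Lemma cdist_tri b a c : cnorm (a - c) <= cnorm (a - b) + cnorm (b - c).
Proof. by have := cnormD (a - b) (b - c); rewrite addrA subrK. Qed.
Lemma cnorm_sum I (s : seq I) (P : pred I) (f : I -> A) :
  cnorm (\sum_(i <- s | P i) f i) <= \sum_(i <- s | P i) cnorm (f i).
Proof.
elim/big_rec2: _ => [|i y x _ le_yx]; first by rewrite cnorm0.
by apply: le_trans (cnormD _ _) _; rewrite lerD2l.
Qed.

Lemma cnormS a : cnorm (star a) = cnorm a.
Proof.
suff le_star b : cnorm b <= cnorm (star b).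
  by apply/eqP; rewrite eq_le le_star andbT -{2}[a]starK le_star.
have [->|b_neq0] := eqVneq (cnorm b) 0; first exact: cnorm_ge0.
have b_gt0 : 0 < cnorm b by rewrite lt_def b_neq0 cnorm_ge0.
by rewrite -(ler_pM2r b_gt0) -expr2 -cnorm_star cnormM.
Qed.

Lemma cnorm1_le1 : cnorm (1 : A) <= 1.
Proof.
have := cnorm_star (1 : A); rewrite star1 mul1r.
by have := cnorm_ge0 (1 : A); nra.
Qed.
Lemma cnorm_creal r : cnorm (creal r) <= `|r|.
Proof.
rewrite -[creal r]mulr1 cnormMreal -[leRHS]mulr1.
by rewrite ler_wpM2l ?cnorm1_le1.
Qed.
Lemma cnorm_sqr h : star h = h -> cnorm (h * h) = cnorm h ^+ 2.
Proof. by move=> hs; rewrite -{1}hs cnorm_star. Qed.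
Lemma sqr_eq0 h : star h = h -> h * h = 0 -> h = 0.
Proof.
move=> hs hh; apply: cnorm_eq0; apply/eqP; rewrite -sqrf_eq0 -cnorm_sqr //.
by rewrite hh cnorm0.
Qed.
Lemma star_mul_eq0 a : star a * a = 0 -> a = 0.
Proof.
move=> aa; apply: cnorm_eq0; apply/eqP.
by rewrite -sqrf_eq0 -cnorm_star aa cnorm0.
Qed.

Lemma eq_of_small a b (M : R) : 0 <= M ->
  (forall e, 0 < e -> cnorm (a - b) <= M * e) -> a = b.
Proof.
move=> M_ge0 small; apply/eqP; rewrite -subr_eq0; apply/eqP/cnorm_eq0/eqP.
rewrite eq_le cnorm_ge0 andbT; apply/ler_addgt0Pr => e e_gt0; rewrite add0r.
have M1_gt0 : 0 < M + 1 by rewrite ltr_wpDl.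
apply: le_trans (small (e / (M + 1)) _) _; first by rewrite divr_gt0.
by rewrite mulrA ler_pdivrMr // mulrC ler_wpM2l ?lerDl // ltW.
Qed.

Lemma converges_unique x l l' :
  converges (@cnorm R A) x l -> converges (@cnorm R A) x l' -> l = l'.
Proof.
move=> xl xl'; apply: (@eq_of_small _ _ 2) => // e e_gt0.
have [N xN] := xl _ e_gt0; have [N' xN'] := xl' _ e_gt0.
have := xN _ (leq_maxl N N'); have := xN' _ (leq_maxr N N').
set p := maxn N N' => lt' lt; rewrite (le_trans (cdist_tri (x p) _ _)) //.
by rewrite cdistC; lra.
Qed.

Lemma convergesD x y l m : converges (@cnorm R A) x l ->
  converges (@cnorm R A) y m -> converges (@cnorm R A) (fun n => x n + y n) (l + m).
Proof.
move=> xl ym e e_gt0; have e2 : 0 < e / 2 by rewrite divr_gt0.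
have [N xN] := xl _ e2; have [N' yN] := ym _ e2.
exists (maxn N N') => p; rewrite geq_max => /andP[/xN xp /yN yp].
rewrite opprD addrACA (le_lt_trans (cnormD _ _)) //; lra.
Qed.

Lemma converges_cst a : converges (@cnorm R A) (fun=> a) a.
Proof. by move=> e e_gt0; exists 0%N => p _; rewrite subrr cnorm0. Qed.

Lemma converges_shift x l : converges (@cnorm R A) x l ->
  converges (@cnorm R A) (fun n => x n.+1) l.
Proof. by move=> xl e /xl [N xN]; exists N => p /leqW /xN. Qed.

Lemma convergesM x y l m : converges (@cnorm R A) x l ->
  converges (@cnorm R A) y m -> converges (@cnorm R A) (fun n => x n * y n) (l * m).
Proof.
move=> xl ym e e_gt0; set M := cnorm l + cnorm m + 1.
have l0 := cnorm_ge0 l; have m0 := cnorm_ge0 m.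
have M_gt0 : 0 < M by rewrite /M; lra.
set d := Num.min 1 (e / (2 * M)).
have d_gt0 : 0 < d by rewrite lt_min ltr01 divr_gt0 ?mulr_gt0.
have d_le1 : d <= 1 by rewrite ge_min lexx.
have dM : d * (2 * M) <= e.
  by rewrite -ler_pdivlMr ?mulr_gt0 // ge_min lexx orbT.
have [N xN] := xl _ d_gt0; have [N' yN] := ym _ d_gt0.
exists (maxn N N') => p; rewrite geq_max => /andP[/xN xp /yN yp].
have -> : x p * y p - l * m = (x p - l) * (y p - m) + (x p - l) * m + l * (y p - m).
  by rewrite -mulrDr subrK mulrBl mulrBr addrA subrK.
have h1 := cnormD ((x p - l) * (y p - m) + (x p - l) * m) (l * (y p - m)).
have h2 := cnormD ((x p - l) * (y p - m)) ((x p - l) * m).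
have h3 := cnormM (x p - l) (y p - m).
have h4 := cnormM (x p - l) m; have h5 := cnormM l (y p - m).
have g1 := cnorm_ge0 (x p - l); have g2 := cnorm_ge0 (y p - m).
rewrite /M in dM *; nra.
Qed.

Lemma converges_star x l : converges (@cnorm R A) x l ->
  converges (@cnorm R A) (fun n => star (x n)) (star l).
Proof. by move=> xl e /xl [N xN]; exists N => p /xN; rewrite -starB cnormS. Qed.

Lemma converges_le x l M : converges (@cnorm R A) x l ->
  (forall n, cnorm (x n) <= M) -> cnorm l <= M.
Proof.
move=> xl xM; apply/ler_addgt0Pr => e e_gt0; have [N /(_ N (leqnn N))] := xl _ e_gt0.
have := cnormD (l - x N) (x N); rewrite subrK cdistC; have := xM N; lra.
Qed.

(** Telescoping bounds [cnorm (x n - x m)] by [q n - q m] for [m <= n], so a bounded real majorant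
    suffices. It serves the square root iteration and a Neumann series. *)
Lemma dominated_converges (x : nat -> A) (q : nat -> R) M :
  (forall n, cnorm (x n.+1 - x n) <= q n.+1 - q n) -> (forall n, q n <= M) ->
  exists l, converges (@cnorm R A) x l.
Proof.
move=> xq q_le; apply: cnorm_complete => e e_gt0.
have q_incr n : q n <= q n.+1.
  by rewrite -subr_ge0 (le_trans (cnorm_ge0 _) (xq n)).
have [N qN] := nondecreasing_bounded_cauchy q_incr q_le e_gt0.
have dom m n : (m <= n)%N -> cnorm (x n - x m) <= q n - q m.
  elim: n => [|n IH]; first by rewrite leqn0 => /eqP->; rewrite !subrr cnorm0.
  rewrite leq_eqVlt => /orP[/eqP->|/IH mn]; first by rewrite !subrr cnorm0.
  by have := cdist_tri (x n) (x n.+1) (x m); have := xq n; lra.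
exists N => m n Nm Nn; have [mn|/ltnW nm] := leqP m n.
  rewrite cdistC; apply: le_lt_trans (dom _ _ mn) _.
  exact: le_lt_trans (ler_norm _) (qN _ _ _ _).
by apply: le_lt_trans (dom _ _ nm) _; apply: le_lt_trans (ler_norm _) (qN _ _ _ _).
Qed.
End CStarAlgebra.

Section SquareRoot.
Variables (R : realType) (A : cstarAlgType R).
Implicit Types (a b c d h z w : A) (r s t : R).

Local Notation "x ~> l" := (converges (@cnorm R A) x l) (at level 70).
Local Notation half := (creal A 2^-1).

(* If [1 - z = (1 - w)^2] then [w = (z + w^2) / 2]; the iterates converge because
   they are dominated by those of the same real recursion started at [z = 1]. *)
Fixpoint sqrt_iter z n : A :=
  if n is m.+1 then half * (z + sqrt_iter z m * sqrt_iter z m) else 0.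

Fixpoint sqrt_bound n : R :=
  if n is m.+1 then (1 + sqrt_bound m ^+ 2) / 2 else 0.

Lemma sqrt_bound_itv n : 0 <= sqrt_bound n <= 1.
Proof.
elim: n => [|n /andP[h1 h2]] /=; rewrite ?lexx ?ler01 //.
by apply/andP; split; nra.
Qed.

Lemma cnorm_sqrt_iter z n : cnorm z <= 1 -> cnorm (sqrt_iter z n) <= sqrt_bound n.
Proof.
move=> z1; elim: n => [|n IH] /=; first by rewrite cnorm0.
rewrite cnormMreal ger0_norm ?invr_ge0 //.
have h1 := cnormD z (sqrt_iter z n * sqrt_iter z n).
have h2 := cnormM (sqrt_iter z n) (sqrt_iter z n).
have /andP[q0 q1] := sqrt_bound_itv n; have w0 := cnorm_ge0 (sqrt_iter z n).
rewrite [leRHS]mulrC ler_pM2l ?invr_gt0 //; nra.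
Qed.

Lemma sqrt_iter_step z n : cnorm z <= 1 ->
  cnorm (sqrt_iter z n.+1 - sqrt_iter z n) <= sqrt_bound n.+1 - sqrt_bound n.
Proof.
move=> z1; elim: n => [|n IH].
  rewrite /= mul0r addr0 subr0 cnormMreal ger0_norm ?invr_ge0 //.
  by rewrite expr0n /= addr0 subr0 mulrC; lra.
rewrite [X in cnorm (X - _)]/= [X in cnorm (_ - X)]/=.
rewrite [X in _ <= X - _]/= [X in _ <= _ - X]/=.
set w := sqrt_iter z n.+1 in IH *; set v := sqrt_iter z n in IH *.
have w_le : cnorm w <= sqrt_bound n.+1 by exact: cnorm_sqrt_iter.
have v_le : cnorm v <= sqrt_bound n by exact: cnorm_sqrt_iter.
set q := sqrt_bound n.+1 in IH w_le *; set p := sqrt_bound n in IH v_le *.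
(* Noncommutative difference of squares: its norm is at most [(q - p) * q + p * (q - p)], which is
   twice the increment of the real recursion. *)
have -> : half * (z + w * w) - half * (z + v * v) = half * ((w - v) * w + v * (w - v)).
  rewrite -mulrBr opprD addrACA subrr add0r; congr (_ * _).
  by rewrite mulrBl mulrBr addrA subrK.
rewrite cnormMreal ger0_norm ?invr_ge0 //.
have h1 := cnormD ((w - v) * w) (v * (w - v)).
have h2 := cnormM (w - v) w; have h3 := cnormM v (w - v).
have := cnorm_ge0 w; have := cnorm_ge0 v; have := cnorm_ge0 (w - v).
have -> : (1 + q ^+ 2) / 2 - (1 + p ^+ 2) / 2 = 2^-1 * ((q - p) * q + p * (q - p)) by field.
rewrite ler_pM2l ?invr_gt0 //; nra.
Qed.

Lemma sqrt_iter_converges z : cnorm z <= 1 -> exists w, sqrt_iter z ~> w.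
Proof.
move=> z1; apply: (@dominated_converges _ _ _ sqrt_bound 1) => n.
  exact: sqrt_iter_step.
by have /andP[] := sqrt_bound_itv n.
Qed.

(* The square root of [a] when [cnorm (1 - a) <= 1]; junk otherwise. *)
Definition csqrt a : A := 1 - xget 0 [set w | sqrt_iter (1 - a) ~> w]%classic.

Lemma csqrtP a : cnorm (1 - a) <= 1 -> sqrt_iter (1 - a) ~> 1 - csqrt a.
Proof.
move=> /sqrt_iter_converges [w wP]; rewrite /csqrt subKr.
by case: xgetP => // /(_ w); rewrite /= => /(_ wP).
Qed.

Lemma csqrt_sqr a : cnorm (1 - a) <= 1 -> csqrt a * csqrt a = a.
Proof.
move=> a1; have wP := csqrtP a1; set w := 1 - csqrt a in wP.
have -> : csqrt a = 1 - w by rewrite /w subKr.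
have wE : w = half * (1 - a + w * w).
  apply: converges_unique (converges_shift wP) _ => /=.
  apply: (convergesM (converges_cst _)); apply: (convergesD (converges_cst _)).
  exact: convergesM.
have w2 : w + w = 1 - a + w * w.
  rewrite [in LHS]wE -mulrDl -crealD.
  have -> : 2^-1 + 2^-1 = 1 :> R by field.
  by rewrite creal1 mul1r.
clearbody w; rewrite mulrBr mulr1 mulrBl mul1r opprB addrACA -opprD w2.
by rewrite addrAC opprD opprB -addrA subrK addrC subrK.
Qed.

Lemma star_csqrt a : star a = a -> cnorm (1 - a) <= 1 -> star (csqrt a) = csqrt a.
Proof.
move=> aS a1; have wP := csqrtP a1.
suff : star (1 - csqrt a) = 1 - csqrt a.
  by rewrite starB star1 => /addrI /oppr_inj.
apply: converges_unique (converges_star wP) _ => e /wP [N wN].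
exists N => p /wN; congr (cnorm (_ - _) < _); elim: p {wN} => [|p IH] /=; first by rewrite star0.
by rewrite starM starD starM -IH starB star1 aS star_creal crealC.
Qed.

Lemma cnorm_1Bcsqrt a : cnorm (1 - a) <= 1 -> cnorm (1 - csqrt a) <= 1.
Proof.
move=> a1; apply: converges_le (csqrtP a1) _ => n.
have /andP[_] := sqrt_bound_itv n; exact: le_trans (cnorm_sqrt_iter _ a1).
Qed.

(** The iterates for [a] and [a'] are the same polynomials in [1 - a] and [1 - a'], so [b]
    intertwines them and then their limits. For [a = a'], the root commutes with all that commutes
    with [a]. *)
Lemma csqrt_intertwine a a' b : cnorm (1 - a) <= 1 -> cnorm (1 - a') <= 1 ->
  b * a = a' * b -> b * csqrt a = csqrt a' * b.
Proof.
move=> a1 a1' ba; suff : b * (1 - csqrt a) = (1 - csqrt a') * b.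
  by rewrite mulrBr mulrBl mulr1 mul1r => /addrI /oppr_inj.
apply: converges_unique (convergesM (converges_cst b) (csqrtP a1)) _.
have := convergesM (csqrtP a1') (converges_cst b).
move=> cv e /cv [N cN]; exists N => p /cN; congr (cnorm (_ - _) < _).
elim: p {cN} => [|p IH] /=; first by rewrite mul0r mulr0.
rewrite mulrA -(crealC _ b) -!mulrA; congr (_ * _).
rewrite mulrDl mulrDr mulrBr mulrBl mulr1 mul1r ba -!mulrA; congr (_ + _).
by rewrite IH mulrA IH mulrA.
Qed.

End SquareRoot.

(** * Positive elements and the Kelley-Vaught theorem *)

Section Positivity.
Variables (R : realType) (A : cstarAlgType R).
Implicit Types (a b c d h k p x : A) (r s t : R).

Let im : A := cunit ('i)%C.

Fact im_sqr : im * im = -1.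
Proof. by rewrite -rmorphM -expr2 sqr_i rmorphN rmorph1. Qed.
Fact star_im : star im = - im.
Proof. by rewrite /im star_cunit -rmorphN; congr (cunit _); rewrite /= conjCi. Qed.
Fact imC a : im * a = a * im.
Proof. exact: cunitC. Qed.

(* The norm of [h] is bounded by that of the normal element [u = h + i k],
   since [2 h = u + u^*]. *)
Lemma cnorm_sqr_leD h k : star h = h -> star k = k -> h * k = k * h ->
  cnorm h ^+ 2 <= cnorm (h * h + k * k).
Proof.
move=> hs ks hk; set u := h + im * k.
have us : star u = h - im * k by rewrite starD starM hs ks star_im mulrN imC.
have <- : star u * u = h * h + k * k.
  have hIk : h * (im * k) = im * k * h by rewrite mulrA -imC -mulrA hk mulrA.
  have IkIk : im * k * (im * k) = - (k * k).
    by rewrite mulrA -[im * k * im]mulrA -imC mulrA im_sqr mulN1r mulNr.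
  by rewrite us mulrDr !mulrBl hIk IkIk opprK addrA subrK.
rewrite cnorm_star ler_sqr ?nnegrE ?cnorm_ge0 //.
have : cnorm (h + h) <= cnorm u + cnorm u.
  rewrite -{2}(cnormS u); apply: le_trans (cnormD _ _).
  by rewrite us /u addrACA addrN addr0.
have -> : h + h = creal A 2 * h by rewrite (crealD _ 1 1) creal1 mulrDl mul1r.
by rewrite cnormMreal ger0_norm //; lra.
Qed.

(* For self-adjoint [a], a nonnegative spectrum without mentioning the spectrum;
   equivalent to [positive a] by the Kelley-Vaught theorem below. *)
Definition cpos a : Prop := star a = a /\ exists t, cnorm (creal A t - a) <= t.

Lemma cposD a b : cpos a -> cpos b -> cpos (a + b).
Proof.
move=> [aS [s aP]] [bS [t bP]]; split; first by rewrite starD aS bS.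
exists (s + t); rewrite crealD opprD addrACA.
by apply: le_trans (cnormD _ _) _; apply: lerD.
Qed.

Lemma cposZ r a : 0 <= r -> cpos a -> cpos (creal A r * a).
Proof.
move=> r0 [aS [t aP]]; split; first by rewrite starM aS star_creal crealC.
by exists (r * t); rewrite crealM -mulrBr cnormMreal ger0_norm // ler_wpM2l.
Qed.

Lemma cpos_sub r a : star a = a -> cnorm a <= r -> cpos (creal A r - a).
Proof.
move=> aS ar; split; first by rewrite starB star_creal aS.
by exists r; rewrite subKr.
Qed.

Lemma cpos_csqrt a : star a = a -> cnorm (1 - a) <= 1 -> cpos (csqrt a).
Proof.
move=> aS a1; split; first exact: star_csqrt.
by exists 1; rewrite creal1 cnorm_1Bcsqrt.
Qed.

(** Scaling by [t^-1] brings [a] within distance 1 of the unit, where [csqrt] is meaningful; [t = 0]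
    forces [a = 0]. The commutation clause stands in for functional calculus. *)
Lemma cpos_sqrt a : cpos a -> exists h, [/\ cpos h, h * h = a &
  forall b, a * b = b * a -> h * b = b * h].
Proof.
move=> [aS [t at_le]]; have := le_trans (cnorm_ge0 _) at_le; rewrite le0r.
case/orP => [/eqP t0|t_gt0].
  exists 0; split=> [|| b _]; last by rewrite mulr0 mul0r.
    by split; [rewrite star0 | exists 0; rewrite creal0 subr0 cnorm0].
  move: at_le; rewrite t0 creal0 sub0r cnormN => a0; rewrite mulr0.
  by apply/esym/cnorm_eq0/eqP; rewrite eq_le a0 cnorm_ge0.
have tK : creal A t * creal A t^-1 = 1 by rewrite -crealM divff ?creal1 ?gt_eqF.
set a' := creal A t^-1 * a.
have a'S : star a' = a' by rewrite starM aS star_creal -crealC.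
have a'1 : cnorm (1 - a') <= 1.
  have := cnormMreal t (1 - a'); rewrite mulrBr mulr1 mulrA tK mul1r.
  by rewrite gtr0_norm // => e1; rewrite -(ler_pM2l t_gt0) mulr1 -e1.
have q0 := sqrtr_ge0 t.
exists (creal A (Num.sqrt t) * csqrt a'); split=> [||b ab].
- by apply: cposZ => //; exact: cpos_csqrt.
- rewrite -mulrA [csqrt a' * _]mulrA -[csqrt a' * creal A _]crealC -mulrA mulrA.
  rewrite -crealM csqrt_sqr //.
  by rewrite -expr2 sqr_sqrtr ?ltW // mulrA tK mul1r.
- rewrite -mulrA crealC [in RHS]crealC mulrA; congr (_ * _).
  apply/esym/csqrt_intertwine => //.
  by rewrite mulrA -[b * _]crealC -!mulrA ab.
Qed.

(** Let [k] be the root of [t - h * h]. The distance is [cnorm k ^+ 2], which is at most the norm of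
    [k * k + h * h], and this sum is the scalar [t]. *)
Lemma cpos_sqr_dist h t : star h = h -> cnorm h ^+ 2 <= t ->
  cnorm (creal A t - h * h) <= t.
Proof.
move=> hs ht; have h2S : star (h * h) = h * h by rewrite starM hs.
have := cpos_sub h2S; rewrite cnorm_sqr // => /(_ _ ht) /cpos_sqrt [k [[ks _] kk kC]].
have kh : k * h = h * k by apply: kC; rewrite mulrBl mulrBr crealC mulrA.
rewrite -kk cnorm_sqr //; apply: le_trans (cnorm_sqr_leD ks hs kh) _.
rewrite kk subrK; apply: le_trans (cnorm_creal _ _) _.
by rewrite ger0_norm // (le_trans _ ht) ?sqr_ge0.
Qed.

Lemma cpos_sqr h : star h = h -> cpos (h * h).
Proof.
move=> hs; split; first by rewrite starM hs.
by exists (cnorm h ^+ 2); exact: cpos_sqr_dist.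
Qed.

Lemma cpos_dist p t : cpos p -> cnorm p <= t -> cnorm (creal A t - p) <= t.
Proof.
move=> /cpos_sqrt [s [[ss _] <- _]]; rewrite cnorm_sqr // => st.
exact: cpos_sqr_dist.
Qed.

(** Same device: write [p = s * s] and [t - p = k * k] with commuting [s] and [k]; then
    [cnorm s ^+ 2] is at most the norm of the scalar [s * s + k * k]. *)
Lemma cpos_cnorm p t : cpos p -> cpos (creal A t - p) -> cnorm p <= `|t|.
Proof.
move=> /cpos_sqrt [s [[ss _] <- sC]] /cpos_sqrt [k [[ks _] kk kC]].
have ks_sk : k * s = s * k by apply: kC; rewrite mulrBl mulrBr crealC mulrA.
rewrite cnorm_sqr //; apply: le_trans (cnorm_creal A t).
by apply: le_trans (cnorm_sqr_leD ss ks _) _; rewrite // kk addrC subrK.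
Qed.

Lemma cpos_antisym p : cpos p -> cpos (- p) -> p = 0.
Proof.
move=> p0 np0; have := @cpos_cnorm p 0 p0; rewrite creal0 sub0r normr0 => /(_ np0) p_le.
by apply/cnorm_eq0/eqP; rewrite eq_le p_le cnorm_ge0.
Qed.

(** For [e = p - d], the positive elements [e p e] and [e d e] add up to [e (p * p - d * d) = 0], so
    both vanish. Their difference is the cube of [e], and a self-adjoint nilpotent is zero. *)
Lemma cpos_sqr_inj p d : cpos p -> cpos d -> p * d = d * p ->
  p * p = d * d -> p = d.
Proof.
move=> pp dp pd ppdd; have [e eE] : exists e, e = p - d by exists (p - d).
have [s [[ss _] sE sC]] := cpos_sqrt pp; have [k [[ks _] kE kC]] := cpos_sqrt dp.
have eS : star e = e by case: pp dp => pS _ [dS _]; rewrite eE starB pS dS.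
have pe : p * e = e * p by rewrite eE mulrBr mulrBl pd.
have de : d * e = e * d by rewrite eE mulrBr mulrBl pd.
have conj_pos x : star x = x -> x * e = e * x -> cpos (e * (x * x) * e).
  move=> xS xe; rewrite mulrA -xe -mulrA.
  by apply: cpos_sqr; rewrite starM xS eS xe.
have epe : cpos (e * p * e) by rewrite -sE; apply: conj_pos => //; exact: sC.
have ede : cpos (e * d * e) by rewrite -kE; apply: conj_pos => //; exact: kC.
have sum0 : e * p * e + e * d * e = 0.
  rewrite -mulrDl -mulrDr -mulrA {2}eE mulrDl !mulrBr ppdd pd addrA subrK.
  by rewrite subrr mulr0.
have epe0 : e * p * e = 0.
  by apply: cpos_antisym => //; rewrite -[- _]addr0 -sum0 addrA addNr add0r.
have ede0 : e * d * e = 0 by move: sum0; rewrite epe0 add0r.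
have eee : e * e * e = 0 by rewrite {2}eE mulrBr mulrBl epe0 ede0 subr0.
apply/eqP; rewrite -subr_eq0 -eE; apply/eqP/sqr_eq0 => //.
by apply: sqr_eq0; [rewrite starM eS | rewrite mulrA eee mul0r].
Qed.

(* Kelley-Vaught: if [c c^* >= 0 >= c^* c] then [c] intertwines [|c^* c| = - c^* c]
   with [|c c^*| = c c^*], so [c c^* c = - c c^* c = 0]. *)
Lemma cpos_flip_eq0 c : cnorm c <= 1 ->
  cpos (c * star c) -> cpos (- (star c * c)) -> c = 0.
Proof.
move=> c1; set X := star c * c; set Z := c * star c => Zpos nXpos.
have cXZ : c * X = Z * c by rewrite /X /Z mulrA.
have X1 : cnorm X <= 1 by rewrite cnorm_star; have := cnorm_ge0 c; nra.
have Z1 : cnorm Z <= 1.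
  by rewrite /Z -{1}[c]starK cnorm_star cnormS; have := cnorm_ge0 c; nra.
have XS : star X = X by rewrite starM starK.
have ZS : star Z = Z by rewrite starM starK.
have sqr_dist h : star h = h -> cnorm h <= 1 -> cnorm (1 - h * h) <= 1.
  move=> hs h1; rewrite -creal1; apply: cpos_sqr_dist => //.
  by have := cnorm_ge0 h; nra.
have csqrt_unique h d : star h = h -> cnorm h <= 1 -> cpos d -> h * d = d * h ->
    h * h = d * d -> csqrt (h * h) = d.
  move=> hs h1 dpos hd hhdd; have hh1 := sqr_dist h hs h1.
  apply: cpos_sqr_inj => //; last by rewrite csqrt_sqr.
    by apply: cpos_csqrt => //; rewrite starM hs.
  by apply/esym/csqrt_intertwine; rewrite // mulrA -hd -!mulrA hd.
have : c * csqrt (X * X) = csqrt (Z * Z) * c.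
  apply: csqrt_intertwine; [exact: sqr_dist | exact: sqr_dist |].
  by rewrite mulrA cXZ -mulrA cXZ mulrA.
rewrite (csqrt_unique X (- X)) ?mulrNN ?mulrN ?mulNr //.
rewrite (csqrt_unique Z Z) // -cXZ => /eqP; rewrite eq_sym -addr_eq0 => /eqP cX2.
have cX0 : c * X = 0.
  have : creal A 2 * (c * X) = 0 by rewrite (crealD _ 1 1) creal1 mulrDl mul1r.
  move/(congr1 ( *%R (creal A 2^-1))); rewrite mulr0 mulrA -crealM.
  by rewrite mulVf ?pnatr_eq0 // creal1 mul1r.
by apply/star_mul_eq0/sqr_eq0 => //; rewrite -/X {1}/X -mulrA cX0 mulr0.
Qed.

Lemma cnorm_normalize a : exists2 r, 0 < r & cnorm (creal A r * a) <= 1.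
Proof.
have a0 := cnorm_ge0 a; have a1 : 0 < cnorm a + 1 by lra.
exists (cnorm a + 1)^-1; first by rewrite invr_gt0.
by rewrite cnormMreal gtr0_norm ?invr_gt0 // mulrC ler_pdivrMr //; lra.
Qed.

Lemma creal_cancel r a : 0 < r -> creal A r^-1 * (creal A r * a) = a.
Proof. by move=> r0; rewrite mulrA -crealM mulVf ?gt_eqF // creal1 mul1r. Qed.

Lemma creal_star_mul r a b :
  star (creal A r * a) * (creal A r * b) = creal A (r * r) * (star a * b).
Proof.
rewrite starM star_creal -mulrA [creal A r * (_ * b)]mulrA -crealM.
by rewrite mulrA -crealC mulrA.
Qed.

Lemma polarization a b :
  (a + b) * (a + b) - (a - b) * (a - b) = creal A 2 * (a * b + b * a).
Proof.
have sqrD x y : (x + y) * (x + y) = x * x + y * y + (x * y + y * x).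
  by rewrite mulrDl !mulrDr [X in _ + X]addrC addrACA.
rewrite !sqrD mulrNN mulrN mulNr -opprD opprB addrC addrA subrK.
by rewrite (crealD _ 1 1) creal1 mulrDl mul1r.
Qed.

(* With [x = b^* b] and [m = |x| - x], the element [c = b m] satisfies
   [c^* c = - m |x| m <= 0]; hence [c = 0], and then [m = 0]. *)
Lemma cpos_star_mul b : cpos (star b * b).
Proof.
wlog b1 : b / cnorm b <= 1.
  have [r r0 b1] := cnorm_normalize b => /(_ _ b1); rewrite creal_star_mul => rpos.
  rewrite -[_ * b](@creal_cancel (r * r)) ?mulr_gt0 //.
  by apply: cposZ => //; rewrite invr_ge0 mulr_ge0 // ltW.
set x := star b * b; have xS : star x = x by rewrite starM starK.
have x1 : cnorm x <= 1 by rewrite cnorm_star; have := cnorm_ge0 b; nra.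
have xx1 : cnorm (1 - x * x) <= 1.
  by rewrite -creal1; apply: cpos_sqr_dist => //; have := cnorm_ge0 x; nra.
have xxS : star (x * x) = x * x by rewrite starM xS.
have Apos := cpos_csqrt xxS xx1; have AA := csqrt_sqr xx1.
have Ax : csqrt (x * x) * x = x * csqrt (x * x).
  by apply/esym/csqrt_intertwine; rewrite // mulrA.
move: (csqrt _) Apos AA Ax => a Apos AA Ax.
have [m mE] : exists m, m = a - x by exists (a - x).
have aS : star a = a by case: Apos.
have mS : star m = m by rewrite mE starB aS xS.
have ma : m * a = - (m * x).
  apply/eqP; rewrite -addr_eq0 -mulrDr mE mulrBl !mulrDr AA Ax.
  by rewrite [X in _ - X]addrC subrr.
have am : a * m = m * a by rewrite mE mulrBr mulrBl Ax.
have mx : m * x = x * m by rewrite mE mulrBr mulrBl Ax.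
set c := b * m.
have cc : star c * c = m * x * m by rewrite starM mS !mulrA.
have ncpos : cpos (- (star c * c)).
  have [k [[ks _] kk kC]] := cpos_sqrt Apos.
  have -> : - (star c * c) = (k * m) * (k * m).
    by rewrite cc -mulNr -ma -kk mulrA -(kC _ am) -!mulrA.
  by apply: cpos_sqr; rewrite starM ks mS kC.
have ccpos : cpos (c * star c).
  have -> : c * star c = creal A 2^-1 *
      ((c + star c) * (c + star c) + im * (c - star c) * (im * (c - star c)))
      + - (star c * c).
    rewrite mulrA -[im * _ * im]mulrA -imC mulrA im_sqr mulN1r mulNr polarization.
    by rewrite mulrA -crealM mulVf ?pnatr_eq0 // creal1 mul1r addrK.
  apply: cposD => //; apply: cposZ; first by rewrite invr_ge0.
  apply: cposD; apply: cpos_sqr; first by rewrite starD starK addrC.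
  by rewrite starM starB starK star_im mulrN -mulNr opprB imC.
have c0 : c = 0.
  have [r r0 c1] := cnorm_normalize c.
  rewrite -[c](creal_cancel c r0) (cpos_flip_eq0 c1) ?mulr0 //.
    rewrite starM star_creal -mulrA [c * _]mulrA -crealC mulrA -crealM.
    by apply: cposZ => //; rewrite mulr_ge0 // ltW.
  rewrite creal_star_mul -mulrN; apply: cposZ => //.
  by rewrite mulr_ge0 // ltW.
have xm0 : x * m = 0 by rewrite -mulrA -/c c0 mulr0.
have m0 : m = 0.
  by apply: sqr_eq0 => //; rewrite {2}mE mulrBr ma mx xm0 oppr0 addr0.
by rewrite -[x]add0r -m0 mE subrK.
Qed.

Lemma positiveE a : positive a <-> cpos a.
Proof.
split=> [[b ->]|/cpos_sqrt [h [[hs _] <- _]]]; first exact: cpos_star_mul.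
by exists h; rewrite hs.
Qed.

Lemma positive_star a : positive a -> star a = a.
Proof. by case=> b ->; rewrite starM starK. Qed.

Lemma positive0 : positive (0 : A).
Proof. by exists 0; rewrite mulr0. Qed.

Lemma positiveD a b : positive a -> positive b -> positive (a + b).
Proof. by rewrite !positiveE; exact: cposD. Qed.

Lemma positive_sum J (s : seq J) (P : pred J) (f : J -> A) :
  (forall j, P j -> positive (f j)) -> positive (\sum_(j <- s | P j) f j).
Proof. by move=> fP; apply: big_ind => //; [exact: positive0 | exact: positiveD]. Qed.

Lemma positiveZ r a : 0 <= r -> positive a -> positive (creal A r * a).
Proof. by rewrite !positiveE; exact: cposZ. Qed.

Lemma positive_conj a b : positive a -> positive (star b * a * b).
Proof. by case=> c ->; exists (c * b); rewrite starM !mulrA. Qed.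

Lemma positive_sqrt a : positive a -> exists h, star h = h /\ h * h = a.
Proof. by rewrite positiveE => /cpos_sqrt [h [[hs _] hh _]]; exists h. Qed.

Lemma positive_subnorm r a : star a = a -> cnorm a <= r -> positive (creal A r - a).
Proof. by rewrite positiveE; exact: cpos_sub. Qed.

Lemma positive_cnorm_le a r : positive a -> positive (creal A r - a) ->
  cnorm a <= `|r|.
Proof. by rewrite !positiveE; exact: cpos_cnorm. Qed.

Lemma le_cnorm_positive a b : positive a -> positive (b - a) -> cnorm a <= cnorm b.
Proof.
move=> a0 ab; rewrite -[cnorm b]ger0_norm ?cnorm_ge0 //.
apply: positive_cnorm_le => //.
have bS : star b = b by rewrite -[b](subrK a) starD !positive_star.
by rewrite -[_ - a](subrKA b); apply: positiveD => //; apply: positive_subnorm.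
Qed.

Lemma positive_closed a :
  (forall e : R, 0 < e -> exists b, positive b /\ cnorm (a - b) <= e) -> positive a.
Proof.
move=> a_lim; apply/positiveE; split.
  apply: (@eq_of_small _ _ _ _ 2) => // e /a_lim [b [/positive_star bS ab]].
  apply: le_trans (cdist_tri b _ _) _.
  have -> : cnorm (star a - b) = cnorm (a - b) by rewrite -{1}bS -starB cnormS.
  by rewrite (cdistC b); lra.
(* The extra 1 lets one radius work for every approximant within distance 1 of [a], so the bound of
   [cpos_dist] passes to the limit. *)
exists (cnorm a + 1); apply/ler_addgt0Pr => e e_gt0.
have d_gt0 : 0 < Num.min 1 e by rewrite lt_min ltr01.
have [b [/positiveE bP ab]] := a_lim _ d_gt0; move: ab; rewrite le_min => /andP[ab1 abe].
have := cnormB a (a - b); rewrite subKr => b_le.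
have := cdist_tri b (creal A (cnorm a + 1)) a; rewrite (cdistC b a) => tri.
have Tb : cnorm (creal A (cnorm a + 1) - b) <= cnorm a + 1.
  by apply: cpos_dist => //; lra.
by lra.
Qed.

(** Partial sums of the Neumann series, over any ring so that one recursion gives both the series in
    [A] and its real majorant. *)
Fixpoint geometric (S : pzRingType) (z : S) n : S :=
  if n is m.+1 then 1 + z * geometric z m else 0.

(** With [t = cnorm a + 1] and [z = 1 - a / t], the hypothesis gives [0 <= z <= 1 - 1 / t], so the
    Neumann series of [z] converges and yields an inverse [w] of [a]. It is positive since
    [w = w a w], and [h] is its root. *)
Lemma inv_sqrt_ge1 a : positive (a - 1) -> exists h, star h = h /\ h * a * h = 1.
Proof.
move=> a1; have aS : star a = a.
  by rewrite -[a](subrK 1) starD star1 positive_star.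
have t0 := cnorm_ge0 a.
set t := cnorm a + 1; have t_gt0 : 0 < t by rewrite /t; lra.
set z := 1 - creal A t^-1 * a.
have tV : creal A t^-1 * creal A t = 1 by rewrite -crealM mulVf ?gt_eqF // creal1.
have zt : z = creal A t^-1 * (creal A t - a) by rewrite mulrBr tV.
have z0 : positive z.
  rewrite zt; apply: positiveZ; first by rewrite invr_ge0 ltW.
  by apply: positive_subnorm => //; rewrite /t; lra.
set q := 1 - t^-1.
have tV0 : 0 < t^-1 by rewrite invr_gt0.
have tV1 : t^-1 <= 1 by rewrite invf_le1 // /t; lra.
have z_le : cnorm z <= q.
  rewrite -[q]ger0_norm ?subr_ge0 //; apply: positive_cnorm_le => //.
  have -> : creal A q - z = creal A t^-1 * (a - 1).
    by rewrite /q /z crealB creal1 opprB addrC subrKA mulrBr mulr1.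
  by apply: positiveZ => //; rewrite ltW.
pose x := geometric z; pose y := geometric q.
have xS n : x n.+1 - 1 = z * x n by rewrite /= addrC addKr.
have yS n : y n.+1 = 1 + q * y n by [].
have x_step n : x n.+2 - x n.+1 = z * (x n.+1 - x n).
  by rewrite mulrBr -!xS opprB addrA subrK.
have y_step n : y n.+2 - y n.+1 = q * (y n.+1 - y n).
  by rewrite !yS mulrBr; ring.
(* The bound [t] is the fixed point of [y |-> 1 + q * y]. *)
have [n|n|l xl] := @dominated_converges _ _ x y t.
- elim: n => [|n IH]; first by rewrite /x /y /= !mulr0 !subr0 !addr0 cnorm1_le1.
  rewrite x_step y_step; apply: le_trans (cnormM _ _) _; apply: ler_pM => //; exact: cnorm_ge0.
- elim: n => [|n IH]; [exact: ltW | rewrite yS].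
  have qt : q * t = t - 1 by rewrite mulrBl mul1r mulVf ?gt_eqF.
  have : q * y n <= q * t by rewrite ler_wpM2l // subr_ge0.
  by rewrite qt; lra.
have lE : l = 1 + z * l.
  apply: converges_unique (converges_shift xl) _ => /=.
  apply: convergesD (converges_cst _) _; exact: convergesM (converges_cst _) xl.
pose w := creal A t^-1 * l.
have aw : a * w = 1.
  rewrite /w mulrA -crealC -[creal _ _ * a](subKr 1) -/z mulrBl mul1r.
  by rewrite {1}lE addrK.
have wS : star w = w.
  have wa : star w * a = 1 by rewrite -[star w * a]starK starM starK aS aw star1.
  by rewrite -[LHS]mulr1 -aw mulrA wa mul1r.
have wa : w * a = 1 by rewrite -[LHS]starK starM wS aS aw star1.
have [h [hS hh]] : exists h, star h = h /\ h * h = w.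
  apply: positive_sqrt; rewrite -[w]mul1r -wa -{1}wS; apply: positive_conj.
  by rewrite -[a](subrK 1); apply: positiveD => //; exists 1; rewrite star1 mul1r.
exists h; split=> //.
(* Multiplying by [1 = w a = h h a] on the right turns [h a h] into [h a (h h) h a]; now [a w = 1]
   collapses it to [h h a = 1]. *)
rewrite -[LHS]mulr1 -[X in _ * X]wa -hh !mulrA -[h * a * h * h]mulrA hh.
by rewrite -[h * a * w]mulrA aw mulr1 hh.
Qed.

End Positivity.

(** * Hilbert modules and their operators *)

Section InnerModules.
Variables (R : realType) (B : cstarAlgType R).

(** Put [w = - b / t] with [t] slightly above [cnorm a], so that [cnorm a = 0] is covered; the
    hypothesis then gives [b^* b <= t c]. No module appears because the lemma is also applied to
    formal lists in the KSGNS construction. *)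
Lemma cauchy_schwarz (a b c : B) : positive a ->
  (forall w, positive (star w * a * w + star w * b + star b * w + c)) ->
  cnorm b ^+ 2 <= cnorm a * cnorm c.
Proof.
move=> a0 pos; have na := cnorm_ge0 a; have nc := cnorm_ge0 c.
apply/ler_addgt0Pr => e e_gt0; set d := e / (cnorm c + 1).
have d_gt0 : 0 < d by rewrite divr_gt0 //; lra.
have dc : d * cnorm c <= e.
  by rewrite /d mulrAC ler_pdivrMr ?ler_wpM2l ?ltW //; lra.
set t := cnorm a + d; have t_gt0 : 0 < t by rewrite /t; lra.
have t_neq0 : t != 0 by rewrite gt_eqF.
suff bc : positive (c - creal B t^-1 * (star b * b)).
  have := le_cnorm_positive _ bc; rewrite cnormMreal cnorm_star gtr0_norm ?invr_gt0 //.
  have -> : t^-1 * cnorm b ^+ 2 <= cnorm c = (cnorm b ^+ 2 <= t * cnorm c).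
    by rewrite mulrC ler_pdivrMr // mulrC.
  rewrite /t mulrDl => /(_ _) le_tc; apply: le_trans (le_tc _) _; last by rewrite lerD2l.
  by apply: positiveZ; [rewrite invr_ge0 ltW | exists b].
pose w := creal B (- t^-1) * b.
have wS : star w = creal B (- t^-1) * star b by rewrite starM star_creal crealC.
have ta : positive (creal B t - a).
  by apply: positive_subnorm; [exact: positive_star | rewrite /t; lra].
have := positiveD (pos w) (positive_conj w ta).
congr positive; rewrite addrC mulrBr mulrBl !addrA subrK.
have -> : star w * creal B t = - star b.
  by rewrite wS -crealC mulrA -crealM mulrN divff // crealN creal1 mulN1r.
have -> : star w * b = - (creal B t^-1 * (star b * b)) by rewrite wS crealN -mulrA mulNr.
by rewrite mulNr [X in X + c]addrAC addNr add0r addrC.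
Qed.

Section Seminorm.
Variable E : innerModType B.
Hypothesis E_pos : forall x : E, positive (rin x x : B).
Implicit Types x y z : E.

Lemma hnorm_ge0 x : 0 <= hnorm x.
Proof. exact: sqrtr_ge0. Qed.

Lemma hnorm_sqr x : hnorm x ^+ 2 = cnorm (rin x x : B).
Proof. by rewrite sqr_sqrtr ?cnorm_ge0. Qed.

Lemma hnorm_le x r : 0 <= r -> cnorm (rin x x : B) <= r ^+ 2 -> hnorm x <= r.
Proof. by move=> r0; rewrite -hnorm_sqr ler_sqr ?nnegrE ?hnorm_ge0. Qed.

(** Derived from positivity alone, since the KSGNS module uses it on the way to its own definiteness
    and completeness. *)
Lemma cnorm_rin_le x y : cnorm (rin x y : B) <= hnorm x * hnorm y.
Proof.
rewrite -ler_sqr ?nnegrE ?cnorm_ge0 ?mulr_ge0 ?hnorm_ge0 // exprMn !hnorm_sqr.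
apply: cauchy_schwarz => // w; have := E_pos (ract x w + y).
have wl z : rin (ract x w) z = star w * rin x z by rewrite -rinC rinA starM rinC.
by congr positive; rewrite rinDr !rinDl !rinA !wl addrACA rinC addrA.
Qed.

Lemma hnorm0 : hnorm (0 : E) = 0.
Proof. by rewrite /hnorm /form_norm rin0r cnorm0 sqrtr0. Qed.

Lemma hnormN x : hnorm (- x) = hnorm x.
Proof. by rewrite /hnorm /form_norm rinNr rinNl opprK. Qed.

Lemma hdistC x y : hnorm (x - y) = hnorm (y - x).
Proof. by rewrite -hnormN opprB. Qed.

Lemma hnormD x y : hnorm (x + y) <= hnorm x + hnorm y.
Proof.
apply: hnorm_le; first by rewrite addr_ge0 ?hnorm_ge0.
rewrite rinDr !rinDl.
have h1 := cnormD (rin x x + rin y x : B) (rin x y + rin y y).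
have h2 := cnormD (rin x x : B) (rin y x); have h3 := cnormD (rin x y : B) (rin y y).
have h4 := cnorm_rin_le x y; have h5 := cnorm_rin_le y x.
have := hnorm_sqr x; have := hnorm_sqr y; nra.
Qed.

Lemma hdist_tri y x z : hnorm (x - z) <= hnorm (x - y) + hnorm (y - z).
Proof. by have := hnormD (x - y) (y - z); rewrite addrA subrK. Qed.

Lemma hnorm_sum I (s : seq I) (P : pred I) (f : I -> E) :
  hnorm (\sum_(i <- s | P i) f i) <= \sum_(i <- s | P i) hnorm (f i).
Proof.
elim/big_rec2: _ => [|i y x _ le_yx]; first by rewrite hnorm0.
by apply: le_trans (hnormD _ _) _; rewrite lerD2l.
Qed.

End Seminorm.

Lemma hilbert_pos (E : innerModType B) : hilbert E -> forall x : E, positive (rin x x : B).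
Proof. by case. Qed.

Lemma hnorm_eq0 (E : innerModType B) (x : E) : hilbert E -> hnorm x = 0 -> x = 0.
Proof.
case=> _ E_def _ x0; apply/E_def/cnorm_eq0.
by rewrite -[LHS]hnorm_sqr x0 expr0n.
Qed.

Lemma eq_of_small_hnorm (E : innerModType B) (x y : E) (M : R) : hilbert E -> 0 <= M ->
  (forall e : R, 0 < e -> hnorm (x - y) <= M * e) -> x = y.
Proof.
move=> hE M_ge0 small; apply/eqP; rewrite -subr_eq0; apply/eqP/(hnorm_eq0 hE)/eqP.
rewrite eq_le hnorm_ge0 andbT; apply/ler_addgt0Pr => e e_gt0; rewrite add0r.
have M1_gt0 : 0 < M + 1 by rewrite ltr_wpDl.
apply: le_trans (small (e / (M + 1)) _) _; first by rewrite divr_gt0.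
by rewrite mulrA ler_pdivrMr // mulrC ler_wpM2l ?lerDl // ltW.
Qed.

Section DirectSum.
Variables (F : innerModType B) (n : nat).
Hypothesis hF : hilbert F.
Implicit Types x y : {ffun 'I_n -> F}.

Lemma dsum_pos x : positive (rin x x : B).
Proof. by apply: positive_sum => i _; exact: hilbert_pos. Qed.

Lemma hnorm_proj_le x i : hnorm (x i) <= hnorm x.
Proof.
rewrite -ler_sqr ?nnegrE ?hnorm_ge0 // !hnorm_sqr; apply: le_cnorm_positive.
  exact: hilbert_pos.
rewrite /rin /= /dsum_rin (bigD1 i) //= addrAC subrr add0r.
by apply: positive_sum => j _; exact: hilbert_pos.
Qed.

Lemma hnorm_dsum_le x : hnorm x <= \sum_i hnorm (x i).
Proof.
apply: hnorm_le; first by apply: sumr_ge0 => i _; exact: hnorm_ge0.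
rewrite /rin /= /dsum_rin; apply: le_trans (cnorm_sum _ _ _) _.
rewrite [leRHS]expr2 mulr_suml; apply: ler_sum => i _.
rewrite -[leLHS]hnorm_sqr expr2 ler_wpM2l ?hnorm_ge0 //.
by rewrite (bigD1 i) //= lerDl; apply: sumr_ge0 => j _; exact: hnorm_ge0.
Qed.

Lemma hilbert_dsum : hilbert {ffun 'I_n -> F}.
Proof.
split; first exact: dsum_pos.
  move=> x /(congr1 (@cnorm R B)); rewrite cnorm0 => x0.
  have {}x0 : hnorm x = 0.
    by rewrite /hnorm /form_norm x0 sqrtr0.
  apply/ffunP => i; rewrite ffunE; apply: hnorm_eq0 => //; apply/eqP.
  by rewrite eq_le hnorm_ge0 -x0 hnorm_proj_le.
move=> x x_cauchy; have [_ _ F_complete] := hF.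
have /choice [l lP] i : exists l : F, forall e : R, 0 < e -> exists N, forall p,
    (N <= p)%N -> hnorm (x p i - l) < e.
  apply: F_complete => e /x_cauchy [N xN]; exists N => p q Np Nq.
  apply: le_lt_trans (xN p q Np Nq); apply: le_trans (hnorm_proj_le _ i).
  by rewrite !ffunE.
exists [ffun i => l i] => e e_gt0; have n1 : 0 < n.+1%:R :> R by rewrite ltr0Sn.
(* Dividing by [n + 1] covers [n = 0] and keeps the total of [n] errors strictly below [e]. *)
have /choice [N NP] i : exists N, forall p, (N <= p)%N -> hnorm (x p i - l i) < e / n.+1%:R.
  by apply: lP; rewrite divr_gt0.
exists (\max_i N i) => p Np; apply: le_lt_trans (hnorm_dsum_le _) _.
apply: (@le_lt_trans _ _ (\sum_(i < n) e / n.+1%:R)).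
  apply: ler_sum => i _; rewrite !ffunE; apply/ltW/NP.
  by apply: leq_trans Np; exact: leq_bigmax.
rewrite sumr_const card_ord -[_ *+ n]mulr_natr mulrAC ltr_pdivrMr // ltr_pM2l //.
by rewrite ltr_nat.
Qed.
End DirectSum.
End InnerModules.

Section AdjointableMaps.
Variables (R : realType) (B : cstarAlgType R).
Implicit Types E F G : innerModType B.

HB.instance Definition _ (F E : innerModType B) (T : adjmap F E) :=
  GRing.isLinear.Build R[i] F E _ T (adjmap_mod T).1.
HB.instance Definition _ (F E : innerModType B) (T : adjmap F E) :=
  GRing.isLinear.Build R[i] E F _ (adjmap_adj T) (adjmap_adj_mod T).1.

Lemma adjmap_sumE F E J (s : seq J) (P : pred J) (T : J -> adjmap F E) x :
  (\sum_(j <- s | P j) T j) x = \sum_(j <- s | P j) T j x.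
Proof. by elim/big_rec2: _ => // j y S _ <-. Qed.

Lemma adjmap_adj_sumE F E J (s : seq J) (P : pred J) (T : J -> adjmap F E) x :
  adjmap_adj (\sum_(j <- s | P j) T j) x = \sum_(j <- s | P j) adjmap_adj (T j) x.
Proof. by elim/big_rec2: _ => // j y S _ <-. Qed.

(* The adjoint is unique, as the form on the source is definite. *)
Lemma adjmap_eq F E (S T : adjmap F E) : hilbert F -> S =1 T -> S = T.
Proof.
case=> _ F_def _ ST; apply: adjmap_ext => // y; apply/eqP; rewrite -subr_eq0.
set z := _ - _; apply/eqP/F_def; rewrite {2}/z rinDr rinNr -!adjmapE ST.
exact: subrr.
Qed.

Lemma bounded_ge0 F E (T : adjmap F E) : bounded_map T ->
  exists2 M, 0 <= M & forall x, hnorm (T x) <= M * hnorm x.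
Proof.
case=> M MP; exists `|M| => // x; apply: le_trans (MP x) _.
by rewrite ler_wpM2r ?hnorm_ge0 ?ler_norm.
Qed.

Lemma bounded_star F E (T : adjmap F E) : hilbert E ->
  bounded_map T -> bounded_map (adjmap_star T).
Proof.
move=> hE /bounded_ge0 [M M0 MP]; exists M => y /=.
have [->|z0] := eqVneq (hnorm (adjmap_adj T y)) 0; first by rewrite mulr_ge0 ?hnorm_ge0.
have z_gt0 : 0 < hnorm (adjmap_adj T y) by rewrite lt_def z0 hnorm_ge0.
rewrite -(ler_pM2r z_gt0) -expr2 hnorm_sqr -adjmapE.
apply: le_trans (cnorm_rin_le (hilbert_pos hE) _ _) _.
by rewrite [leRHS]mulrAC ler_wpM2r ?hnorm_ge0.
Qed.

Lemma bounded_comp F E G (S : adjmap E G) (T : adjmap F E) :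
  bounded_map S -> bounded_map T -> bounded_map (adjmap_comp S T).
Proof.
move=> /bounded_ge0 [M M0 MP] [N NP]; exists (M * N) => x /=.
by apply: le_trans (MP _) _; rewrite -mulrA ler_wpM2l.
Qed.

Lemma bounded_sum F E J (s : seq J) (T : J -> adjmap F E) : hilbert E ->
  (forall j, bounded_map (T j)) -> bounded_map (\sum_(j <- s) T j).
Proof.
move=> hE /choice [M MP]; exists (\sum_(j <- s) M j) => x.
rewrite adjmap_sumE mulr_suml; apply: le_trans (hnorm_sum (hilbert_pos hE) _ _ _) _.
exact: ler_sum.
Qed.

Lemma bounded_adjmap_of_mx F n (T : 'M[adjmap F F]_n) : hilbert F ->
  (forall i j, bounded_map (T i j)) -> bounded_map (adjmap_of_mx T).
Proof.
move=> hF T_bdd.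
have /choice [M MP] (p : 'I_n * 'I_n) : exists M, 0 <= M /\
    forall x, hnorm (T p.1 p.2 x) <= M * hnorm x.
  by have [M] := bounded_ge0 (T_bdd p.1 p.2); exists M.
exists (\sum_i \sum_j M (i, j)) => x.
apply: le_trans (hnorm_dsum_le _) _; rewrite mulr_suml; apply: ler_sum => i _.
rewrite ffunE mulr_suml; apply: le_trans (hnorm_sum (hilbert_pos hF) _ _ _) _.
apply: ler_sum => j _; have [M0 /(_ (x j)) /= le_Mx] := MP (i, j).
by apply: le_trans le_Mx _; rewrite ler_wpM2l ?hnorm_proj_le.
Qed.
(** A definite form determines a vector by its pairings, so having an adjoint forces linearity.
    Operators can then be given by two functions and the adjunction identity. *)
Lemma module_map_adjoint F E (f : F -> E) (g : E -> F) : hilbert E ->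
  (forall x y, rin (f x) y = rin x (g y) :> B) -> module_map f.
Proof.
move=> [_ E_def _] fg.
have rin_inj (y z : E) : (forall w, rin y w = rin z w :> B) -> y = z.
  move=> yz; apply/eqP; rewrite -subr_eq0; apply/eqP/E_def.
  by rewrite rinDl rinNl yz subrr.
split=> [k x y|x b]; apply: rin_inj => w.
  by rewrite fg !rinDl !rinZl !fg.
have ractl (G : innerModType B) (y z : G) c : rin (ract y c) z = star c * rin y z :> B.
  by rewrite -rinC rinA starM rinC.
by rewrite fg !ractl fg.
Qed.

Definition mk_adjmap F E (hF : hilbert F) (hE : hilbert E) (f : F -> E) (g : E -> F)
    (fg : forall x y, rin (f x) y = rin x (g y) :> B) : adjmap F E :=
  Adjmap (module_map_adjoint hE fg)
    (module_map_adjoint hF (fun x y => etrans (esym (rinC _ _))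
      (etrans (congr1 star (esym (fg y x))) (rinC _ _)))) fg.

End AdjointableMaps.

(** * The C*-algebra of bounded adjointable operators on a Hilbert module *)

Section OperatorAlgebra.
Variables (R : realType) (B : cstarAlgType R) (E : innerModType B).

Lemma normc_conj (k : R[i]) : Normc.normc (Num.conj k) = Normc.normc k.
Proof. by case: k => a b /=; rewrite sqrrN. Qed.

Lemma normc_ge0 (k : R[i]) : 0 <= Normc.normc k.
Proof. by case: k => a b; exact: sqrtr_ge0. Qed.

Lemma hnormZ (k : R[i]) (x : E) : hnorm (k *: x) = Normc.normc k * hnorm x.
Proof.
rewrite /hnorm /form_norm rinZr rinZl !cnormZ normc_conj mulrA -expr2.
by rewrite sqrtrM ?sqr_ge0 // sqrtr_sqr ger0_norm ?normc_ge0.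
Qed.

Definition bounded_op : {pred adjmap E E} := fun T => `[< bounded_map T >].

(* B_B(E) for a Hilbert module E; the unused argument is the hypothesis under
   which it is a C*-algebra. *)
Record opalg (hE : hilbert E) := OpAlg {
  opval : adjmap E E; opvalP : opval \in bounded_op }.

Variable hE : hilbert E.
Let E_pos := hilbert_pos hE.

Lemma bounded_opP T : reflect (bounded_map T) (T \in bounded_op).
Proof. exact: asboolP. Qed.

Fact bounded_op_subring : subring_closed bounded_op.
Proof.
split=> [|S T /bounded_opP[M MP] /bounded_opP[N NP]|S T /bounded_opP SM /bounded_opP TM].
- by apply/bounded_opP; exists 1 => x; rewrite mul1r.
- apply/bounded_opP; exists (M + N) => x.
  have -> : (S - T) x = S x - T x by rewrite /= scaleN1r.
  by apply: le_trans (hnormD E_pos _ _) _; rewrite hnormN mulrDl lerD.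
- exact/bounded_opP/bounded_comp.
Qed.

HB.instance Definition _ := [isSub for @opval hE].
HB.instance Definition _ := [Choice of opalg hE by <:].
HB.instance Definition _ :=
  GRing.SubChoice_isSubPzRing.Build _ _ (opalg hE) bounded_op_subring.

Implicit Types (S T : opalg hE) (k : R[i]) (x : E).

Lemma opval_bounded T : bounded_map (opval T).
Proof. exact/bounded_opP/opvalP. Qed.

Lemma opalg_eq S T : opval S =1 opval T -> S = T.
Proof. by move=> ST; apply/val_inj/adjmap_eq. Qed.

Definition opstar T : opalg hE :=
  OpAlg hE (introT (bounded_opP _) (bounded_star hE (opval_bounded T))).

Fact opstarK : involutive opstar.
Proof. by move=> T; exact: opalg_eq. Qed.
Fact opstarD : {morph opstar : S T / S + T}.
Proof. by move=> S T; exact: opalg_eq. Qed.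
Fact opstarM S T : opstar (S * T) = opstar T * opstar S.
Proof. exact: opalg_eq. Qed.
HB.instance Definition _ := PzRing_isStarRing.Build (opalg hE) opstarK opstarD opstarM.

(** The condition [0 <= M] matters on the zero module, where every real number would otherwise be a
    bound and the set would have no infimum. *)
Definition opbounds T : set R :=
  [set M | 0 <= M /\ forall x, hnorm (opval T x) <= M * hnorm x]%classic.
Definition opnorm T : R := inf (opbounds T).

Lemma opbounds_inf T : has_inf (opbounds T).
Proof.
split; last by exists 0 => M [].
by have [M M0 MP] := bounded_ge0 (opval_bounded T); exists M.
Qed.

Lemma opnorm_ge0 T : 0 <= opnorm T.
Proof. by apply: lb_le_inf => [|M []//]; case: (opbounds_inf T). Qed.

Lemma opnorm_le T M : 0 <= M -> (forall x, hnorm (opval T x) <= M * hnorm x) ->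
  opnorm T <= M.
Proof. by move=> M0 MP; apply: ge_inf; [case: (opbounds_inf T) | split]. Qed.

Lemma opnormP T x : hnorm (opval T x) <= opnorm T * hnorm x.
Proof.
have [x0|x_neq0] := eqVneq (hnorm x) 0.
  have [M M0 MP] := bounded_ge0 (opval_bounded T).
  by have := MP x; rewrite x0 !mulr0.
have x_gt0 : 0 < hnorm x by rewrite lt_def x_neq0 hnorm_ge0.
rewrite -ler_pdivrMr //; apply: lb_le_inf; first by case: (opbounds_inf T).
by move=> M [_ MP]; rewrite ler_pdivrMr.
Qed.

Fact opunit_bounded k : adjmap_scale k (adjmap1 E) \in bounded_op.
Proof. by apply/bounded_opP; exists (Normc.normc k) => x; rewrite /= hnormZ. Qed.
Definition opunit k : opalg hE := OpAlg hE (opunit_bounded k).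

Fact opunit_zmod : zmod_morphism opunit.
Proof. by move=> k h; apply: opalg_eq => x; rewrite /= scaleN1r scalerBl. Qed.
Fact opunit_monoid : monoid_morphism opunit.
Proof.
split=> [|k h]; apply: opalg_eq => x /=; first by rewrite scale1r.
by rewrite scalerA.
Qed.
HB.instance Definition _ := GRing.isZmodMorphism.Build _ _ opunit opunit_zmod.
HB.instance Definition _ := GRing.isMonoidMorphism.Build _ _ opunit opunit_monoid.

Fact opunitC k T : opunit k * T = T * opunit k.
Proof. by apply: opalg_eq => x /=; rewrite linearZ. Qed.
Fact star_opunit k : star (opunit k) = opunit (Num.conj k).
Proof. by apply: opalg_eq. Qed.
Fact opnorm_eq0 T : opnorm T = 0 -> T = 0.
Proof.
move=> T0; apply: opalg_eq => x; apply: (hnorm_eq0 hE); apply/eqP.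
by rewrite eq_le hnorm_ge0 andbT -[leRHS](mul0r (hnorm x)) -T0 opnormP.
Qed.
Fact opnormD S T : opnorm (S + T) <= opnorm S + opnorm T.
Proof.
apply: opnorm_le => [|x]; first by rewrite addr_ge0 ?opnorm_ge0.
apply: le_trans (hnormD E_pos _ _) _.
by rewrite mulrDl lerD ?opnormP.
Qed.
Fact opnormM S T : opnorm (S * T) <= opnorm S * opnorm T.
Proof.
apply: opnorm_le => [|x]; first by rewrite mulr_ge0 ?opnorm_ge0.
apply: le_trans (opnormP S (opval T x)) _.
by rewrite -mulrA ler_wpM2l ?opnorm_ge0 ?opnormP.
Qed.
Fact opnormZ_le k T : opnorm (opunit k * T) <= Normc.normc k * opnorm T.
Proof.
apply: opnorm_le => [|x]; first by rewrite mulr_ge0 ?normc_ge0 ?opnorm_ge0.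
have -> : opval (opunit k * T) x = k *: opval T x by [].
by rewrite hnormZ -mulrA; apply: ler_wpM2l; [exact: normc_ge0 | exact: opnormP].
Qed.
Fact opnormZ k T : opnorm (opunit k * T) = Normc.normc k * opnorm T.
Proof.
apply/eqP; rewrite eq_le opnormZ_le /=.
have [->|k0] := eqVneq k 0; first by rewrite Normc.normc0 mul0r opnorm_ge0.
have nk : 0 < Normc.normc k.
  by rewrite lt_def normc_ge0 andbT; apply: contra_neq k0; exact: Normc.eq0_normc.
rewrite mulrC -ler_pdivlMr // mulrC -Normc.normcV.
apply: le_trans (opnormZ_le _ _).
by rewrite mulrA -rmorphM mulVf // rmorph1 mul1r.
Qed.
Fact opnorm_sqr_le T : opnorm T ^+ 2 <= opnorm (star T * T).
Proof.
have TT0 := opnorm_ge0 (star T * T).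
rewrite -[leRHS]sqr_sqrtr // ler_sqr ?nnegrE ?opnorm_ge0 ?sqrtr_ge0 //.
apply: opnorm_le => [|x]; first exact: sqrtr_ge0.
rewrite -ler_sqr ?nnegrE ?mulr_ge0 ?sqrtr_ge0 ?hnorm_ge0 // exprMn.
rewrite [X in _ <= X * _]sqr_sqrtr //.
rewrite [leLHS]hnorm_sqr adjmapE; apply: le_trans (cnorm_rin_le E_pos _ _) _.
rewrite [leLHS]mulrC [_ ^+ 2]expr2 mulrA ler_wpM2r ?hnorm_ge0 //.
exact: (opnormP (star T * T)).
Qed.
Fact opnorm_star T : opnorm (star T) = opnorm T.
Proof.
have le_star S : opnorm S <= opnorm (star S).
  have [->|S_neq0] := eqVneq (opnorm S) 0; first exact: opnorm_ge0.
  have S_gt0 : 0 < opnorm S by rewrite lt_def S_neq0 opnorm_ge0.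
  by rewrite -(ler_pM2r S_gt0) -expr2 (le_trans (opnorm_sqr_le S)) ?opnormM.
by apply/eqP; rewrite eq_le (le_star T) andbT -{2}[T]starK le_star.
Qed.
Fact opnorm_starM T : opnorm (star T * T) = opnorm T ^+ 2.
Proof.
apply/eqP; rewrite eq_le opnorm_sqr_le andbT (le_trans (opnormM _ _)) //.
by rewrite opnorm_star expr2.
Qed.

Lemma opvalB S T x : opval (S - T) x = opval S x - opval T x.
Proof. by rewrite /= scaleN1r. Qed.

(** Only a bare function is produced. Applied to a sequence and to its adjoints it gives two limits
    adjoint to each other, and [mk_adjmap] makes an operator of them. *)
Lemma opnorm_cauchy_lim (T : nat -> opalg hE) :
  (forall e : R, 0 < e -> exists N, forall p q,
    (N <= p)%N -> (N <= q)%N -> opnorm (T p - T q) < e) ->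
  exists f : E -> E, forall e : R, 0 < e -> exists N, forall p, (N <= p)%N ->
    forall x, hnorm (opval (T p) x - f x) <= e * hnorm x.
Proof.
move=> T_cauchy; have [_ _ E_complete] := hE.
have /choice [f fP] x : exists l, forall e : R, 0 < e -> exists N, forall p,
    (N <= p)%N -> hnorm (opval (T p) x - l) < e.
  apply: E_complete => e e_gt0; have x0 := hnorm_ge0 x.
  have [N TN] : exists N, forall p q, (N <= p)%N -> (N <= q)%N ->
      opnorm (T p - T q) < e / (hnorm x + 1).
    by apply: T_cauchy; rewrite divr_gt0 //; lra.
  exists N => p q Np Nq; rewrite -[form_norm _ _]/(hnorm _) -opvalB.
  apply: le_lt_trans (opnormP _ _) _; apply: (@le_lt_trans _ _ (e / (hnorm x + 1) * hnorm x)).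
    by rewrite ler_wpM2r ?hnorm_ge0 // ltW ?TN.
  by rewrite mulrAC ltr_pdivrMr ?ltr_pM2l //; lra.
exists f => e e_gt0; have [N TN] := T_cauchy _ e_gt0; exists N => p Np x.
apply/ler_addgt0Pr => d /(fP x) [N' fN]; pose q := maxn N N'.
have := fN q (leq_maxr _ _); have := TN p q Np (leq_maxl _ _) => lt_e lt_d.
apply: le_trans (hdist_tri E_pos (opval (T q) x) _ _) _.
rewrite -opvalB; apply: lerD; last exact: ltW.
apply: le_trans (opnormP _ _) _.
by rewrite ler_wpM2r ?hnorm_ge0 // ltW.
Qed.

Fact opnorm_complete : seq_complete opnorm.
Proof.
move=> T T_cauchy; have [f fP] := opnorm_cauchy_lim T_cauchy.
have [g gP] : exists g : E -> E, forall e : R, 0 < e -> exists N, forall p, (N <= p)%N ->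
    forall x, hnorm (opval (star (T p)) x - g x) <= e * hnorm x.
  apply: opnorm_cauchy_lim => e /T_cauchy [N TN]; exists N => p q Np Nq.
  by rewrite -starN -starD opnorm_star TN.
have fg x y : rin (f x) y = rin x (g y) :> B.
  apply: (@eq_of_small _ _ _ _ (2 * (hnorm x * hnorm y))) => [|e e_gt0].
    by rewrite !mulr_ge0 ?hnorm_ge0.
  have [N fN] := fP _ e_gt0; have [N' gN] := gP _ e_gt0; pose p := maxn N N'.
  have := fN p (leq_maxl _ _) x; have := gN p (leq_maxr _ _) y => g_le f_le.
  apply: le_trans (cdist_tri (rin (opval (T p) x) y) _ _) _.
  rewrite -rinNl -rinDl adjmapE -rinNr -rinDr.
  have h1 := cnorm_rin_le E_pos (f x - opval (T p) x) y.
  have h2 := cnorm_rin_le E_pos x (opval (star (T p)) y - g y).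
  rewrite hdistC in h1; have x0 := hnorm_ge0 x; have y0 := hnorm_ge0 y.
  have h3 : hnorm (opval (T p) x - f x) * hnorm y <= e * hnorm x * hnorm y.
    by rewrite ler_wpM2r.
  have h4 : hnorm x * hnorm (opval (star (T p)) y - g y) <= hnorm x * (e * hnorm y).
    by rewrite ler_wpM2l.
  apply: le_trans (lerD h1 h2) _; lra.
pose S := mk_adjmap hE hE fg.
have S_bdd : S \in bounded_op.
  apply/bounded_opP; have [N /(_ N (leqnn N)) fN] := fP _ ltr01.
  exists (opnorm (T N) + 1) => x /=; have := hnormD E_pos (f x - opval (T N) x) (opval (T N) x).
  by rewrite subrK hdistC; have := fN x; have := opnormP (T N) x; lra.
exists (OpAlg hE S_bdd) => e e_gt0; have e2 : 0 < e / 2 by rewrite divr_gt0.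
have [N fN] := fP _ e2; exists N => p Np; apply: (@le_lt_trans _ _ (e / 2)); last by lra.
by apply: opnorm_le => [|x]; [exact: ltW | rewrite opvalB; exact: fN].
Qed.

HB.instance Definition _ := isCStarAlgebra.Build R (opalg hE) opunitC star_opunit
  opnorm_eq0 opnormD opnormZ opnormM opnorm_starM opnorm_complete.

End OperatorAlgebra.

(** * Matrices of operators as operators on direct sums *)

Section OperatorMatrices.
Variables (R : realType) (B : cstarAlgType R) (F : innerModType B).
Hypothesis hF : hilbert F.

Lemma adjmap_of_mxM n (S T : 'M[adjmap F F]_n) :
  adjmap_of_mx (S * T) = adjmap_of_mx S * adjmap_of_mx T.
Proof.
apply: adjmap_eq => [|x]; first exact: hilbert_dsum.
apply/ffunP => i; rewrite !ffunE /=.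
under eq_bigr do rewrite mxE adjmap_sumE.
rewrite exchange_big /=; apply: eq_bigr => k _.
by rewrite ffunE linear_sum.
Qed.

Lemma adjmap_of_mx_sum n J (s : seq J) (T : J -> 'M[adjmap F F]_n) :
  adjmap_of_mx (\sum_(j <- s) T j) = \sum_(j <- s) adjmap_of_mx (T j).
Proof.
apply: adjmap_eq => [|x]; first exact: hilbert_dsum.
apply/ffunP => i; rewrite adjmap_sumE sum_ffunE ffunE.
under eq_bigr do rewrite summxE adjmap_sumE.
by rewrite exchange_big /=; apply: eq_bigr => k _; rewrite ffunE.
Qed.

Lemma adjmap_of_mx_star n (T : 'M[adjmap F F]_n) :
  adjmap_of_mx (star T) = star (adjmap_of_mx T).
Proof.
by apply: adjmap_ext => x; apply/ffunP => i; rewrite !ffunE;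
   apply: eq_bigr => j _; rewrite mxE.
Qed.

Definition opinj n (j : 'I_n) : adjmap F {ffun 'I_n -> F}.
Proof.
refine (@mk_adjmap _ _ _ _ hF (hilbert_dsum n hF)
  (fun x : F => [ffun i => if i == j then x else 0] : {ffun 'I_n -> F})
  (fun y : {ffun 'I_n -> F} => y j) _) => x y.
rewrite [LHS](bigD1 j) //= ffunE eqxx big1 ?addr0 // => i /negPf ij.
by rewrite ffunE ij rin0l.
Defined.

Definition mx_of_adjmap n (T : adjmap {ffun 'I_n -> F} {ffun 'I_n -> F}) :
    'M[adjmap F F]_n :=
  \matrix_(i, j) adjmap_comp (adjmap_star (opinj i)) (adjmap_comp T (opinj j)).

Lemma mx_of_adjmapK n (T : adjmap {ffun 'I_n -> F} {ffun 'I_n -> F}) :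
  adjmap_of_mx (mx_of_adjmap T) = T.
Proof.
apply: adjmap_eq => [|x]; first exact: hilbert_dsum.
have {2}-> : x = \sum_j opinj j (x j).
  apply/ffunP => i; rewrite sum_ffunE (bigD1 i) //= ffunE eqxx big1 ?addr0 // => j.
  by rewrite eq_sym => /negPf ji; rewrite ffunE ji.
rewrite linear_sum; apply/ffunP => i; rewrite sum_ffunE ffunE.
by apply: eq_bigr => j _; rewrite mxE.
Qed.

Lemma adjmap_of_mxK n (T : 'M[adjmap F F]_n) : mx_of_adjmap (adjmap_of_mx T) = T.
Proof.
apply/matrixP => i j; rewrite mxE; apply: adjmap_eq => // x.
rewrite [LHS]ffunE (bigD1 j) //= ffunE eqxx big1 ?addr0 // => k /negPf kj.
by rewrite ffunE kj linear0.
Qed.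

(* Matrices of operators have no C*-norm here, so the sum of squares is taken in
   the C*-algebra of operators on the direct sum. *)
Lemma positive_opmx_sum n J (s : seq J) (T : J -> 'M[adjmap F F]_n) :
  (forall j, positive (T j)) -> (forall j i k, bounded_map (T j i k)) ->
  positive (\sum_(j <- s) T j).
Proof.
move=> /choice [b bP] T_bdd; pose hFn := hilbert_dsum n hF.
(* [positive] says nothing of the size of the factor [b j]; the identity [<b x, b x> = <x, T x>]
   bounds it by the square root of a bound for [T j]. *)
have b_bdd j : adjmap_of_mx (b j) \in @bounded_op R B {ffun 'I_n -> F}.
  have [M M0 MP] := bounded_ge0 (bounded_adjmap_of_mx hF (T_bdd j)).
  apply/bounded_opP; exists (Num.sqrt M) => x.
  rewrite -ler_sqr ?nnegrE ?mulr_ge0 ?sqrtr_ge0 ?hnorm_ge0 // exprMn (sqr_sqrtr M0).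
  rewrite [leLHS]hnorm_sqr adjmapE.
  have -> : adjmap_adj (adjmap_of_mx (b j)) (adjmap_of_mx (b j) x) = adjmap_of_mx (T j) x.
    by rewrite bP adjmap_of_mxM adjmap_of_mx_star.
  apply: le_trans (cnorm_rin_le (hilbert_pos hFn) _ _) _.
  by rewrite [leLHS]mulrC [_ ^+ 2]expr2 mulrA ler_wpM2r ?hnorm_ge0.
pose S j := OpAlg hFn (b_bdd j).
have [c cP] : positive (\sum_(j <- s) star (S j) * S j).
  by apply: positive_sum => j _; exists (S j).
exists (mx_of_adjmap (opval c)); rewrite -[LHS]adjmap_of_mxK -[RHS]adjmap_of_mxK.
congr mx_of_adjmap; rewrite adjmap_of_mxM adjmap_of_mx_star mx_of_adjmapK.
rewrite adjmap_of_mx_sum -[RHS]/(opval (star c * c)) -cP.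
rewrite -[RHS]/(\val (\sum_(j <- s) star (S j) * S j)) raddf_sum.
by apply: eq_bigr => j _; rewrite bP adjmap_of_mxM adjmap_of_mx_star.
Qed.

(** The identification of [M_mn(B_B(F))] with [M_m(B_B(F^n))]: Gram matrices of [psi] live in the
    former, complete positivity of [phi] is a statement about the latter. *)
Definition mxblocks m n (T : 'M[adjmap F F]_(m * n)) :
    'M[adjmap {ffun 'I_n -> F} {ffun 'I_n -> F}]_m :=
  \matrix_(i, j) adjmap_of_mx
    (\matrix_(k, l) T (mxvec_index i k) (mxvec_index j l)).

Lemma positive_mxblocks m n (T : 'M[adjmap F F]_(m * n)) :
  positive T -> positive (mxblocks T).
Proof.
case=> b ->; exists (mxblocks b); apply/matrixP => i j; rewrite mxE [RHS]mxE.
have -> : (\matrix_(k, l) (star b * b) (mxvec_index i k) (mxvec_index j l))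
    = \sum_p star (\matrix_(k, l) b (mxvec_index p k) (mxvec_index i l))
        * (\matrix_(k, l) b (mxvec_index p k) (mxvec_index j l)).
  apply/matrixP => k l; rewrite !mxE summxE.
  rewrite (reindex _ (curry_mxvec_bij m n)) /=.
  under [RHS]eq_bigr do rewrite mxE.
  rewrite pair_bigA /=; apply: eq_bigr => -[p q] _ /=.
  by rewrite !mxE.
rewrite adjmap_of_mx_sum; apply: eq_bigr => p _.
by rewrite adjmap_of_mxM adjmap_of_mx_star !mxE.
Qed.
End OperatorMatrices.

(** * The KSGNS construction *)

Section KernelFunctions.
Variables (R : realType) (B D : cstarAlgType R) (F : innerModType B).
Variable psi : D -> adjmap F F.
Implicit Types (L M : seq (D * F)) (f g h : D -> F) (d a : D) (k : R[i]) (r s e : R).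

(* A list [(d_1, x_1), ..., (d_m, x_m)] stands for the element of the KSGNS
   module that is the sum of the [pi(d_i) V x_i]; an element [f] of that module is
   identified with the function [d |-> V^* pi(d)^* f], so that [kfun L] is the
   function of [L], [pairing L f] is the inner product of [L] and [f], and
   [kbdd f r] says that the norm of [f] is at most [r]. The module consists of the
   functions that are limits of functions [kfun L] in this norm. *)
Definition pairing L g : B := \sum_(p <- L) rin p.2 (g p.1).
Definition kfun L : D -> F := fun d => \sum_(p <- L) psi (star d * p.1) p.2.
Definition lnorm L : R := Num.sqrt (cnorm (pairing L (kfun L))).

Definition kbdd g r : Prop :=
  0 <= r /\ forall L, cnorm (pairing L g) <= r * lnorm L.

Definition in_ksgns : {pred D -> F} :=
  fun g => `[< forall e, 0 < e -> exists L, kbdd (g - kfun L) e >].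

Definition lscale k L : seq (D * F) := [seq (p.1, k *: p.2) | p <- L].
Definition lract L (b : B) : seq (D * F) := [seq (p.1, ract p.2 b) | p <- L].
Definition llact d L : seq (D * F) := [seq (d * p.1, p.2) | p <- L].

Lemma pairing_cat L M g : pairing (L ++ M) g = pairing L g + pairing M g.
Proof. exact: big_cat. Qed.
Lemma pairing_scale k L g : pairing (lscale k L) g = cscale (Num.conj k) (pairing L g).
Proof.
rewrite /pairing big_map cscale_sumr.
by apply: eq_bigr => p _ /=; rewrite rinZl.
Qed.
Lemma pairing_ract L b g : pairing (lract L b) g = star b * pairing L g.
Proof.
rewrite /pairing big_map mulr_sumr.
by apply: eq_bigr => p _ /=; rewrite -rinC rinA starM rinC.
Qed.
Lemma pairing_lact d L g : pairing (llact d L) g = pairing L (fun c => g (d * c)).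
Proof. by rewrite /pairing big_map. Qed.
Lemma pairingD L g h : pairing L (g + h) = pairing L g + pairing L h.
Proof. by rewrite /pairing -big_split; apply: eq_bigr => p _; exact: rinDr. Qed.
Lemma pairingZ L k g : pairing L (k *: g) = cscale k (pairing L g).
Proof. by rewrite /pairing cscale_sumr; apply: eq_bigr => p _; exact: rinZr. Qed.
Lemma pairingN L g : pairing L (- g) = - pairing L g.
Proof. by rewrite -scaleN1r pairingZ cscaleN1. Qed.
Lemma pairingB L g h : pairing L (g - h) = pairing L g - pairing L h.
Proof. by rewrite pairingD pairingN. Qed.
Lemma pairing0 L : pairing L 0 = 0.
Proof. by rewrite -(scale0r 0) pairingZ cscale0. Qed.
Lemma pairing_ractr L g b : pairing L (fun d => ract (g d) b) = pairing L g * b.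
Proof. by rewrite /pairing mulr_suml; apply: eq_bigr => p _; rewrite rinA. Qed.
Lemma pairingNl L g : pairing (lscale (-1) L) g = - pairing L g.
Proof. by rewrite pairing_scale rmorphN rmorph1 cscaleN1. Qed.

Lemma kfun_cat L M : kfun (L ++ M) = kfun L + kfun M.
Proof. by apply/funext => d; exact: big_cat. Qed.
Lemma kfun_scale k L : kfun (lscale k L) = k *: kfun L.
Proof.
apply/funext => d; rewrite /kfun big_map [RHS]scaler_sumr.
by apply: eq_bigr => p _; rewrite linearZ.
Qed.
Lemma kfun_ract L b : kfun (lract L b) = (fun d => ract (kfun L d) b).
Proof.
apply/funext => d; rewrite /kfun big_map.
rewrite (big_morph (ract^~ b) (fun y z => ractDl y z b) (ract0l F b)).
by apply: eq_bigr => p _ /=; have [_ ->] := adjmap_mod (psi (star d * p.1)).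
Qed.
Lemma kfun_nil : kfun [::] = 0.
Proof. by apply/funext => d; exact: big_nil. Qed.
Lemma kfun_lact a L : kfun (llact a L) = (fun d => kfun L (star a * d)).
Proof.
apply/funext => d; rewrite /kfun big_map.
by apply: eq_bigr => p _; rewrite starM starK mulrA.
Qed.

Lemma lnorm_ge0 L : 0 <= lnorm L. Proof. exact: sqrtr_ge0. Qed.
Lemma lnorm_sqr L : lnorm L ^+ 2 = cnorm (pairing L (kfun L)).
Proof. by rewrite sqr_sqrtr ?cnorm_ge0. Qed.

Lemma kbdd_le g r s : r <= s -> kbdd g r -> kbdd g s.
Proof.
move=> rs [r0 gP]; split=> [|L]; first exact: le_trans rs.
by apply: le_trans (gP L) _; rewrite ler_wpM2r ?lnorm_ge0.
Qed.
Lemma kbdd_lin k g h r s : kbdd g r -> kbdd h s -> kbdd (k *: g + h) (Normc.normc k * r + s).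
Proof.
move=> [r0 gP] [s0 hP]; split=> [|L]; first by rewrite addr_ge0 // mulr_ge0 ?normc_ge0.
rewrite pairingD pairingZ; apply: le_trans (cnormD _ _) _; rewrite mulrDl lerD //.
by rewrite cnormZ -mulrA ler_wpM2l ?normc_ge0.
Qed.
Lemma kbdd0 r : 0 <= r -> kbdd 0 r.
Proof. by split=> // L; rewrite pairing0 cnorm0 mulr_ge0 ?lnorm_ge0. Qed.
Lemma kbddD g h r s : kbdd g r -> kbdd h s -> kbdd (g + h) (r + s).
Proof. by move=> gr /(kbdd_lin 1 gr); rewrite scale1r Normc.normc1 mul1r. Qed.
Lemma kbddN g r : kbdd g r -> kbdd (- g) r.
Proof. by case=> r0 gP; split=> // L; rewrite pairingN cnormN. Qed.
Lemma kbddB g h r s : kbdd g r -> kbdd h s -> kbdd (g - h) (r + s).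
Proof. by move=> gr /kbddN; exact: kbddD. Qed.
Lemma kbdd_distC g h r : kbdd (g - h) r -> kbdd (h - g) r.
Proof. by move/kbddN; rewrite opprB. Qed.

Lemma lnorm_le M r : kbdd (kfun M) r -> lnorm M <= r.
Proof.
case=> r0 /(_ M); rewrite -lnorm_sqr => h.
have [->//|M0] := eqVneq (lnorm M) 0.
have M_gt0 : 0 < lnorm M by rewrite lt_def M0 lnorm_ge0.
by rewrite -(ler_pM2r M_gt0) -expr2.
Qed.

Lemma in_ksgnsP g : reflect (forall e, 0 < e -> exists L, kbdd (g - kfun L) e) (g \in in_ksgns).
Proof. exact: asboolP. Qed.

Fact in_ksgns_submod : submod_closed in_ksgns.
Proof.
split=> [|k g h /in_ksgnsP gP /in_ksgnsP hP]; apply/in_ksgnsP => e e_gt0.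
  by exists [::]; rewrite kfun_nil subr0; exact/kbdd0/ltW.
have k0 := normc_ge0 k; have nk : 0 < 2 * (Normc.normc k + 1) by lra.
have [|L LP] := gP (e / (2 * (Normc.normc k + 1))); first by rewrite divr_gt0.
have [|M MP] := hP (e / 2); first by rewrite divr_gt0.
exists (lscale k L ++ M); rewrite kfun_cat kfun_scale opprD addrACA -scalerBr.
apply: kbdd_le (kbdd_lin k LP MP).
rewrite mulrA.
suff : Normc.normc k * e / (2 * (Normc.normc k + 1)) <= e / 2 by lra.
by rewrite ler_pdivrMr //; nra.
Qed.

Hypotheses (hF : hilbert F) (hpsi : cp_map psi).

Lemma psiD a d : psi (a + d) = psi a + psi d.
Proof. by have := cp_linear hpsi 1 a d; rewrite /cscale rmorph1 mul1r scale1r. Qed.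
Lemma psi0 : psi 0 = 0.
Proof. by apply: (addrI (psi 0)); rewrite -psiD !addr0. Qed.
Lemma psiZ k a : psi (cscale k a) = k *: psi a.
Proof. by have := cp_linear hpsi k a 0; rewrite psi0 !addr0. Qed.

(** The Gram matrix of [d] is [star b * b] for the square matrix [b] with first row [d] and zeros
    below; the empty matrix, which has no first row, is treated apart. *)
Lemma psi_gram m (d : 'I_m -> D) : positive (\matrix_(i, j) psi (star (d i) * d j)).
Proof.
case: m d => [|m] d; first by exists 0; apply/matrixP => -[].
have -> : \matrix_(i, j) psi (star (d i) * d j) = map_mx psi (\matrix_(i, j) (star (d i) * d j)).
  by apply/matrixP => i j; rewrite !mxE.
apply: (cp_positive hpsi); exists (\matrix_(i, j) if i == ord0 then d j else 0).
apply/matrixP => i j; rewrite !mxE (bigD1 ord0) //= !mxE eqxx big1 ?addr0 // => l /negPf l0.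
by rewrite !mxE l0 star0 mul0r.
Qed.

(** The Gram matrix of the pair [(1, a)] has [psi a] and [psi (star a)] off the diagonal, and a
    positive matrix is self-adjoint. *)
Lemma psi_star a : psi (star a) = adjmap_star (psi a).
Proof.
have [b bP] := psi_gram (fun i : 'I_2 => if i == ord0 then 1 else a).
have /matrixP gS : star (star b * b) = star b * b by rewrite starM starK.
by have := gS ord_max ord0; rewrite -bP !mxE /= star1 mul1r mulr1 => <-.
Qed.

Lemma pairing_kfunC L M : star (pairing L (kfun M)) = pairing M (kfun L).
Proof.
rewrite /pairing star_sum; under eq_bigr do rewrite rinC rin_suml.
rewrite exchange_big /=; apply: eq_bigr => q _; rewrite rin_sumr; apply: eq_bigr => p _.
by rewrite adjmapE -[adjmap_adj _]/(adjmap_fun (adjmap_star _)) -psi_star starM starK.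
Qed.

(** Factoring the Gram matrix of [psi] as [star b * b] turns the pairing into the sum of the inner
    squares of the coordinates of [b x]. *)
Lemma pairing_pos L : positive (pairing L (kfun L)).
Proof.
rewrite /pairing /kfun big_tnth; under eq_bigr do rewrite big_tnth.
set m := size L; pose d i := (tnth (in_tuple L) i).1; pose x i := (tnth (in_tuple L) i).2.
have [b bP] := psi_gram d.
have -> : \sum_(i < m) rin (x i) (\sum_(j < m) psi (star (d i) * d j) (x j))
    = \sum_l rin (\sum_i b l i (x i)) (\sum_j b l j (x j)) :> B.
  under [RHS]eq_bigr do rewrite rin_suml.
  rewrite exchange_big /=; apply: eq_bigr => i _.
  under [RHS]eq_bigr do rewrite adjmapE linear_sum.
  rewrite -rin_sumr exchange_big /=; congr rin; apply: eq_bigr => j _.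
  move/matrixP: bP => /(_ i j); rewrite mxE => ->; rewrite mxE adjmap_sumE.
  by apply: eq_bigr => l _; rewrite mxE.
by apply: positive_sum => l _; exact: hilbert_pos.
Qed.

Lemma cnorm_pairing_le L M : cnorm (pairing L (kfun M)) <= lnorm L * lnorm M.
Proof.
rewrite -ler_sqr ?nnegrE ?cnorm_ge0 ?mulr_ge0 ?lnorm_ge0 // exprMn !lnorm_sqr.
apply: cauchy_schwarz => [|w]; first exact: pairing_pos.
have := pairing_pos (lract L w ++ M); congr positive.
rewrite pairing_cat kfun_cat !pairingD kfun_ract !pairing_ract !pairing_ractr.
by rewrite mulrA addrA pairing_kfunC.
Qed.

Lemma kbdd_kfun M : kbdd (kfun M) (lnorm M).
Proof. by split=> [|L]; [exact: lnorm_ge0 | rewrite mulrC cnorm_pairing_le]. Qed.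

(** This is [<L, pi(c) L>], written out through [psi] because [pi] is not yet available. *)
Definition quad L c : B :=
  \sum_(p <- L) rin p.2 (\sum_(q <- L) psi (star p.1 * c * q.1) q.2).

Lemma quadB L c d : quad L (c - d) = quad L c - quad L d.
Proof.
rewrite /quad -sumrB; apply: eq_bigr => p _; rewrite -rinNr -rinDr -sumrB; congr rin.
apply: eq_bigr => q _; rewrite mulrBr mulrBl psiD.
have -> : psi (- (star p.1 * d * q.1)) = - psi (star p.1 * d * q.1).
  by apply/eqP; rewrite -addr_eq0 -psiD addNr psi0.
by rewrite /= scaleN1r.
Qed.

Lemma quad_creal L r : quad L (creal D r) = creal B r * quad L 1.
Proof.
rewrite /quad mulr_sumr; apply: eq_bigr => p _.
rewrite -[_ * rin _ _]/(cscale _ _) -rinZr scaler_sumr; congr rin.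
apply: eq_bigr => q _; rewrite mulr1 -crealC -mulrA.
by rewrite -[creal D r * _]/(cscale _ _) psiZ.
Qed.

Lemma pairing_llact a L : pairing (llact a L) (kfun (llact a L)) = quad L (star a * a).
Proof.
rewrite pairing_lact kfun_lact; apply: eq_bigr => p _; congr rin.
by apply: eq_bigr => q _; rewrite starM starM starK !mulrA.
Qed.

(** Write [cnorm a ^+ 2 - star a * a] as [star e * e]; by linearity of [quad L], the gap between the
    two squared forms is the inner square of [llact e L]. *)
Lemma lnorm_llact a L : lnorm (llact a L) <= cnorm a * lnorm L.
Proof.
have [e eP] : positive (creal D (cnorm a ^+ 2) - star a * a).
  by apply: positive_subnorm; rewrite ?starM ?starK // cnorm_star.
rewrite -ler_sqr ?nnegrE ?mulr_ge0 ?cnorm_ge0 ?lnorm_ge0 // exprMn !lnorm_sqr.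
rewrite -[cnorm a ^+ 2]ger0_norm ?sqr_ge0 // -cnormMreal; apply: le_cnorm_positive.
  exact: pairing_pos.
have -> : pairing L (kfun L) = quad L 1.
  by apply: eq_bigr => p _; congr rin; apply: eq_bigr => q _; rewrite mulr1.
rewrite pairing_llact -quad_creal -quadB eP -pairing_llact; exact: pairing_pos.
Qed.

Lemma kbdd_lact a g r : kbdd g r -> kbdd (fun d => g (star a * d)) (cnorm a * r).
Proof.
case=> r0 gP; split=> [|L]; first by rewrite mulr_ge0 ?cnorm_ge0.
rewrite -pairing_lact; apply: le_trans (gP _) _.
rewrite [cnorm a * r]mulrC -mulrA ler_wpM2l // (le_trans (lnorm_llact _ _)) //.
by rewrite cnormS.
Qed.

Lemma kbdd_ract (b : B) g r : kbdd g r -> kbdd (fun d => ract (g d) b) (r * cnorm b).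
Proof.
case=> r0 gP; split=> [|L]; first by rewrite mulr_ge0 ?cnorm_ge0.
rewrite pairing_ractr; apply: le_trans (cnormM _ _) _.
by rewrite mulrAC ler_wpM2r ?cnorm_ge0.
Qed.

(** Pair [g] with the one-term list [(d, g d)], whose norm is controlled by a bound for
    [psi (star d * d)]. This continuity of evaluation underlies definiteness and completeness of the
    module. *)
Lemma kbdd_eval d : exists2 C, 0 <= C & forall g r, kbdd g r -> hnorm (g d) <= C * r.
Proof.
have [C C0 CP] := bounded_ge0 (cp_bounded hpsi (star d * d)).
exists (Num.sqrt C) => [|g r [r0 gP]]; first exact: sqrtr_ge0.
have [->|g0] := eqVneq (hnorm (g d)) 0; first by rewrite mulr_ge0 ?sqrtr_ge0.
have g_gt0 : 0 < hnorm (g d) by rewrite lt_def g0 hnorm_ge0.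
have := gP [:: (d, g d)]; rewrite /lnorm /pairing /kfun !big_seq1 /= -hnorm_sqr => h.
rewrite -(ler_pM2r g_gt0) -expr2; apply: le_trans h _.
rewrite [_ * r]mulrC -mulrA ler_wpM2l //.
rewrite -ler_sqr ?nnegrE ?mulr_ge0 ?sqrtr_ge0 ?hnorm_ge0 // exprMn (sqr_sqrtr C0).
rewrite [leLHS]sqr_sqrtr ?cnorm_ge0 //.
apply: le_trans (cnorm_rin_le (hilbert_pos hF) _ _) _.
by rewrite expr2 mulrA [C * _]mulrC -mulrA ler_wpM2l ?hnorm_ge0.
Qed.

Lemma in_ksgns_kbdd g : g \in in_ksgns -> exists s, kbdd g s.
Proof.
move=> /in_ksgnsP /(_ 1 ltr01) [L LP]; exists (1 + lnorm L).
by rewrite -[g](subrK (kfun L)); apply: kbddD LP (kbdd_kfun L).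
Qed.

Lemma in_ksgns_kfun L : kfun L \in in_ksgns.
Proof. by apply/in_ksgnsP => e /ltW e0; exists L; rewrite subrr; exact: kbdd0. Qed.

(* The inner product of [f] and [g] is the limit of [pairing L g] as [kfun L] tends
   to [f]. *)
Definition ip_spec f g (b : B) : Prop :=
  forall L r s, kbdd (f - kfun L) r -> kbdd g s -> cnorm (b - pairing L g) <= r * s.

Definition ip f g : B := xget 0 [set b | ip_spec f g b]%classic.

Lemma cnorm_pairing_sub L M g r s : kbdd (kfun L - kfun M) r -> kbdd g s ->
  cnorm (pairing L g - pairing M g) <= r * s.
Proof.
move=> LM [s0 gP]; rewrite -pairingNl -pairing_cat; apply: le_trans (gP _) _.
rewrite mulrC ler_wpM2r //; apply: lnorm_le.
by rewrite kfun_cat kfun_scale scaleN1r.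
Qed.

Lemma ip_exists f g : f \in in_ksgns -> g \in in_ksgns -> exists b, ip_spec f g b.
Proof.
move=> /in_ksgnsP fP /in_ksgns_kbdd [s gs]; have s0 : 0 <= s by case: gs.
have /choice [L LP] (n : nat) : exists L, kbdd (f - kfun L) n.+1%:R^-1.
  by apply: fP; rewrite invr_gt0.
have L_dist M r n : kbdd (f - kfun M) r -> kbdd (kfun (L n) - kfun M) (n.+1%:R^-1 + r).
  by move=> fM; rewrite -[_ - _](subrKA f); apply: kbddD => //; exact: kbdd_distC.
have [b bP] : exists b, converges (@cnorm R B) (fun n => pairing (L n) g) b.
  apply: cnorm_complete => e e_gt0.
  have [||N NP] := @inv_nat_small R (2 * s) e; rewrite ?mulr_ge0 //.
  exists N => p q /NP Np /NP Nq.
  apply: le_lt_trans (cnorm_pairing_sub (L_dist _ _ p (LP q)) gs) _.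
  by move: (p.+1%:R^-1) (q.+1%:R^-1) Np Nq => x y; lra.
exists b => M r t fM gt; apply/ler_addgt0Pr => e e_gt0.
have e2 : 0 < e / 2 by rewrite divr_gt0.
have [N1 N1P] := bP _ e2.
have t0 : 0 <= t by case: gt.
have [N2 N2P] := inv_nat_small t0 e2.
have := N1P _ (leq_maxl N1 N2); have := N2P _ (leq_maxr N1 N2).
set n := maxn N1 N2 => h2 h1.
apply: le_trans (cdist_tri (pairing (L n) g) _ _) _; rewrite cdistC.
by have := cnorm_pairing_sub (L_dist _ _ n fM) gt; move: (n.+1%:R^-1) h2 => y; lra.
Qed.

Lemma ipP f g : f \in in_ksgns -> g \in in_ksgns -> ip_spec f g (ip f g).
Proof.
move=> fH gH; rewrite /ip; case: xgetP => //= none.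
by have [b /(none b)] := ip_exists fH gH.
Qed.

Lemma ip_eq f g b (C : R) : f \in in_ksgns -> g \in in_ksgns -> 0 <= C ->
  (forall L e, 0 < e -> kbdd (f - kfun L) e -> cnorm (b - pairing L g) <= C * e) ->
  ip f g = b.
Proof.
move=> fH gH C0 bP; have [s gs] := in_ksgns_kbdd gH; have s0 : 0 <= s by case: gs.
apply: (@eq_of_small _ _ _ _ (s + C)) => [|e e_gt0]; first exact: addr_ge0.
have [L LP] := in_ksgnsP _ fH _ e_gt0.
apply: le_trans (cdist_tri (pairing L g) _ _) _; rewrite [X in _ + X]cdistC.
have := ipP fH gH LP gs; have := bP _ _ e_gt0 LP; lra.
Qed.

Lemma ip_kfun L g : g \in in_ksgns -> ip (kfun L) g = pairing L g.
Proof.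
move=> gH; have [s gs] := in_ksgns_kbdd gH; have s0 : 0 <= s by case: gs.
apply: (@ip_eq _ _ _ s) => // [|M e _ LM]; first exact: in_ksgns_kfun.
by rewrite mulrC; exact: cnorm_pairing_sub.
Qed.

Lemma cnorm_ip_le f g r s : f \in in_ksgns -> g \in in_ksgns ->
  kbdd f r -> kbdd g s -> cnorm (ip f g) <= r * s.
Proof.
move=> fH gH fr gs; have := ipP fH gH (L := [::]); rewrite kfun_nil subr0.
by move=> /(_ _ _ fr gs); rewrite /pairing big_nil subr0.
Qed.

End KernelFunctions.

(** * The kernel functions as a Hilbert module with a representation *)

Section KSGNSModule.
Variables (R : realType) (B D : cstarAlgType R) (F : innerModType B).
Variable psi : D -> adjmap F F.

(* The unused arguments are the hypotheses under which this is a Hilbert module. *)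
Record ksgns (hF : hilbert F) (hpsi : cp_map psi) :=
  KSGNS { kval :> D -> F; kvalP : kval \in in_ksgns psi }.

Variables (hF : hilbert F) (hpsi : cp_map psi).
Local Notation H := (ksgns hF hpsi).
Implicit Types (u v w : H) (L M : seq (D * F)) (a d : D) (k : R[i]).

HB.instance Definition _ := [isSub for @kval hF hpsi].
HB.instance Definition _ := [Choice of H by <:].
HB.instance Definition _ :=
  GRing.SubChoice_isSubLmodule.Build _ _ _ H (in_ksgns_submod psi).

Lemma ksgns_eq u v : (forall d, u d = v d) -> u = v.
Proof. by move=> uv; apply/val_inj/funext. Qed.

Definition kelt L : H := KSGNS hF hpsi (in_ksgns_kfun psi L).

Fact in_ksgns_ract u (b : B) : (fun d => ract (u d) b) \in in_ksgns psi.
Proof.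
apply/in_ksgnsP => e e_gt0; have b0 := cnorm_ge0 b.
have [|L LP] := in_ksgnsP _ _ (kvalP u) (e / (cnorm b + 1)).
  by rewrite divr_gt0 //; lra.
exists (lract L b); rewrite kfun_ract.
have -> : (fun d => ract (u d) b) - (fun d => ract (kfun psi L d) b)
    = (fun d => ract ((val u - kfun psi L) d) b).
  by apply/funext => d; rewrite -[LHS]/(_ - _) -ractNl -ractDl.
apply: kbdd_le (kbdd_ract b LP).
by rewrite mulrAC ler_pdivrMr ?ler_wpM2l ?ltW //; lra.
Qed.

Definition ksgns_ract u (b : B) : H := KSGNS hF hpsi (in_ksgns_ract u b).
Definition ksgns_rin u v : B := ip psi u v.

Fact ksgns_ractDl u v b : ksgns_ract (u + v) b = ksgns_ract u b + ksgns_ract v b.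
Proof. by apply: ksgns_eq => d; exact: ractDl. Qed.
Fact ksgns_ractDr u b c : ksgns_ract u (b + c) = ksgns_ract u b + ksgns_ract u c.
Proof. by apply: ksgns_eq => d; exact: ractDr. Qed.
Fact ksgns_ractZl k u b : ksgns_ract (k *: u) b = k *: ksgns_ract u b.
Proof. by apply: ksgns_eq => d; exact: ractZl. Qed.
Fact ksgns_ractZr k u b : ksgns_ract u (cscale k b) = k *: ksgns_ract u b.
Proof. by apply: ksgns_eq => d; exact: ractZr. Qed.
Fact ksgns_ractA u b c : ksgns_ract u (b * c) = ksgns_ract (ksgns_ract u b) c.
Proof. by apply: ksgns_eq => d; exact: ractA. Qed.
Fact ksgns_ract1 u : ksgns_ract u 1 = u.
Proof. by apply: ksgns_eq => d; exact: ract1. Qed.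

Lemma ksgns_kbdd u : exists s, kbdd psi u s.
Proof. exact: in_ksgns_kbdd (kvalP u). Qed.
Lemma ksgns_approx u (e : R) : 0 < e -> exists L, kbdd psi (kval u - kfun psi L) e.
Proof. by move=> e_gt0; have /in_ksgnsP := kvalP u; apply. Qed.

Lemma ksgns_rin_eq u v b (C : R) : 0 <= C ->
  (forall L (e : R), 0 < e -> kbdd psi (kval u - kfun psi L) e ->
    cnorm (b - pairing L v) <= C * e) ->
  ksgns_rin u v = b.
Proof. exact: ip_eq (kvalP u) (kvalP v). Qed.

Lemma ksgns_rinP u v : ip_spec psi u v (ksgns_rin u v).
Proof. exact: ipP (kvalP u) (kvalP v). Qed.

Lemma ksgns_rin_kelt L u : ksgns_rin (kelt L) u = pairing L u.
Proof. exact: ip_kfun (kvalP u). Qed.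

Fact ksgns_rinDr u v w : ksgns_rin u (v + w) = ksgns_rin u v + ksgns_rin u w.
Proof.
have [s vs] := ksgns_kbdd v; have [t wt] := ksgns_kbdd w.
apply: (@ksgns_rin_eq _ _ _ (s + t)) => [|L e e_gt0 LP].
  by case: vs => s0 _; case: wt => t0 _; rewrite addr_ge0.
rewrite pairingD opprD addrACA mulrDl.
apply: le_trans (cnormD _ _) _; rewrite [s * e]mulrC [t * e]mulrC.
by apply: lerD; apply: ksgns_rinP.
Qed.
Fact ksgns_rinZr k u v : ksgns_rin u (k *: v) = cscale k (ksgns_rin u v).
Proof.
have [s vs] := ksgns_kbdd v; have s0 : 0 <= s by case: vs.
apply: (@ksgns_rin_eq _ _ _ (Normc.normc k * s)) => [|L e e_gt0 LP].
  by rewrite mulr_ge0 ?normc_ge0.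
rewrite pairingZ /cscale -mulrBr cnormZ -mulrA ler_wpM2l ?normc_ge0 //.
by rewrite mulrC; apply: ksgns_rinP.
Qed.
Fact ksgns_rinA u v b : ksgns_rin u (ksgns_ract v b) = ksgns_rin u v * b.
Proof.
have [s vs] := ksgns_kbdd v; have s0 : 0 <= s by case: vs.
apply: (@ksgns_rin_eq _ _ _ (s * cnorm b)) => [|L e e_gt0 LP].
  by rewrite mulr_ge0 ?cnorm_ge0.
rewrite pairing_ractr -mulrBl; apply: le_trans (cnormM _ _) _.
by rewrite mulrAC ler_wpM2r ?cnorm_ge0 // mulrC; apply: ksgns_rinP.
Qed.

Fact ksgns_rinC u v : star (ksgns_rin u v) = ksgns_rin v u.
Proof.
have [s us] := ksgns_kbdd u; have [t vt] := ksgns_kbdd v.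
have s0 : 0 <= s by case: us.
have t0 : 0 <= t by case: vt.
(* With [u] approximated within [d] and [v] within [e], the three replacements cost [d * t],
   [e * (s + d)] and [d * (t + e)]. As [d] is at most 1 and at most [e], the total is at most this
   constant times [e]. *)
apply/esym/(@ksgns_rin_eq _ _ _ (2 * t + s + 2)) => [|M e e_gt0 MP].
  by rewrite !addr_ge0 ?mulr_ge0.
set d := Num.min 1 e; have d_gt0 : 0 < d by rewrite lt_min ltr01.
have d_le1 : d <= 1 by rewrite ge_min lexx.
have d_lee : d <= e by rewrite ge_min lexx orbT.
have [L LP] := ksgns_approx u d_gt0.
have L_le : lnorm psi L <= s + d.
  apply: lnorm_le; rewrite -[kfun psi L](subKr (kval u)); exact: kbddB.
have M_le : lnorm psi M <= t + e.
  apply: lnorm_le; rewrite -[kfun psi M](subKr (kval v)); exact: kbddB.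
have h1 := ksgns_rinP LP vt.
have h2 := MP.2 L; rewrite pairingB in h2.
have h3 := LP.2 M; rewrite pairingB -pairing_kfunC // cdistC in h3.
apply: le_trans (cdist_tri (star (pairing L v)) _ _) _.
have := cdist_tri (star (pairing L (kfun psi M))) (star (pairing L v)) (pairing M u).
rewrite -!starB !cnormS.
have h4 : e * lnorm psi L <= e * (s + 1) by apply: ler_wpM2l; [exact: ltW | lra].
have h5 : d * lnorm psi M <= d * (t + e) by apply: ler_wpM2l; [exact: ltW |].
have h6 : d * (t + e) <= e * t + e by nra.
have h7 : d * t <= e * t by rewrite ler_wpM2r.
lra.
Qed.

HB.instance Definition _ := isInnerModule.Build R B H
  ksgns_ractDl ksgns_ractDr ksgns_ractZl ksgns_ractZr ksgns_ractA ksgns_ract1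
  ksgns_rinDr ksgns_rinZr ksgns_rinA ksgns_rinC.

Lemma cnorm_krin_le u v r s : kbdd psi u r -> kbdd psi v s ->
  cnorm (rin u v : B) <= r * s.
Proof. exact: cnorm_ip_le (kvalP u) (kvalP v). Qed.

Lemma ksgns_pos u : positive (rin u u : B).
Proof.
apply: positive_closed => e e_gt0; have [s us] := ksgns_kbdd u.
have s0 : 0 <= s by case: us.
set d := Num.min 1 (e / (2 * s + 1)); have s1 : 0 < 2 * s + 1 by lra.
have d_gt0 : 0 < d by rewrite lt_min ltr01 divr_gt0.
have d_le1 : d <= 1 by rewrite ge_min lexx.
have d_le : d * (2 * s + 1) <= e by rewrite -ler_pdivlMr // ge_min lexx orbT.
have [L LP] := ksgns_approx u d_gt0.
exists (rin (kelt L) (kelt L)); split.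
  by rewrite -[rin _ _]/(ksgns_rin _ _) ksgns_rin_kelt; exact: pairing_pos.
have L_le : kbdd psi (kelt L) (s + d).
  by rewrite -[kval (kelt L)](subKr (kval u)); exact: kbddB.
have -> : rin u u - rin (kelt L) (kelt L) =
    rin (u - kelt L) u + rin (kelt L) (u - kelt L) :> B.
  by rewrite rinDl rinDr rinNl rinNr addrA subrK.
apply: le_trans (cnormD _ _) _.
have h1 : cnorm (rin (u - kelt L) u : B) <= d * s by exact: cnorm_krin_le.
have h2 : cnorm (rin (kelt L) (u - kelt L) : B) <= (s + d) * d by exact: cnorm_krin_le.
nra.
Qed.

Lemma kbdd_hnorm u : kbdd psi u (hnorm u).
Proof.
split=> [|L]; first exact: hnorm_ge0.
have := cnorm_rin_le ksgns_pos (kelt L) u.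
rewrite -[rin _ u]/(ksgns_rin _ u) ksgns_rin_kelt mulrC.
suff -> : hnorm (kelt L) = lnorm psi L by [].
by rewrite /hnorm /form_norm -[rin _ _]/(ksgns_rin _ _) ksgns_rin_kelt.
Qed.

Lemma hnorm_kbdd u r : kbdd psi u r -> hnorm u <= r.
Proof.
move=> ur; have r0 : 0 <= r by case: ur.
by apply: hnorm_le => //; rewrite expr2; exact: cnorm_krin_le.
Qed.

Lemma ksgns_eval_le d : exists2 C, 0 <= C & forall u, hnorm (u d) <= C * hnorm u.
Proof.
have [C C0 CP] := kbdd_eval hF hpsi d.
by exists C => // u; exact/CP/kbdd_hnorm.
Qed.

(** The limit is taken pointwise. Pairing with a fixed list is a finite sum and passes to the limit,
    which turns the Cauchy estimate into a [kbdd] bound with the same [e] for all lists. *)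
Lemma ksgns_complete : seq_complete (@hnorm R B H).
Proof.
move=> x x_cauchy; have [_ _ F_complete] := hF.
have /choice [f fP] d : exists l : F, forall e : R, 0 < e -> exists N, forall p,
    (N <= p)%N -> hnorm (x p d - l) < e.
  apply: F_complete => e e_gt0; have [C C0 CP] := ksgns_eval_le d.
  have C1 : 0 < C + 1 by lra.
  have [N xN] := x_cauchy (e / (C + 1)) (divr_gt0 e_gt0 C1).
  exists N => p q /xN Np /Np; rewrite ltr_pdivlMr // => lt_e.
  have := CP (x p - x q); have := hnorm_ge0 (x p - x q).
  rewrite -[kval (x p - x q) d]/(x p d - x q d) -[form_norm _ _]/(hnorm (x p d - x q d)); lra.
have pairing_lim L (e : R) : 0 < e -> exists N, forall p, (N <= p)%N ->
    cnorm (pairing L (f - kval (x p))) <= e.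
  elim: L e => [|[d y] L IH] e e_gt0.
    by exists 0%N => p _; rewrite /pairing big_nil cnorm0 ltW.
  have e2 : 0 < e / 2 by rewrite divr_gt0.
  have y0 := hnorm_ge0 y; have y1 : 0 < hnorm y + 1 by lra.
  have [N NP] := IH _ e2; have [N' N'P] := fP d _ (divr_gt0 e2 y1).
  exists (maxn N N') => p; rewrite geq_max => /andP[/NP h1 /N'P].
  rewrite ltr_pdivlMr // hdistC => h2.
  rewrite /pairing big_cons -/(pairing L _); apply: le_trans (cnormD _ _) _.
  have /= := cnorm_rin_le (hilbert_pos hF) y (f d - x p d).
  have := hnorm_ge0 (f d - x p d).
  rewrite -[(f - kval (x p)) d]/(f d - x p d); nra.
have f_lim (e : R) : 0 < e -> exists N, forall p, (N <= p)%N -> kbdd psi (f - kval (x p)) e.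
  move=> e_gt0; have [N xN] := x_cauchy _ e_gt0; exists N => p Np.
  split=> [|L]; first exact: ltW.
  apply/ler_addgt0Pr => d /(pairing_lim L) [N' N'P].
  have /ltW := xN _ _ (leq_maxl N N') Np; have := N'P _ (leq_maxr N N').
  set q := maxn N N' => h1 h2.
  rewrite -[f - _](subrKA (kval (x q))) pairingD; apply: le_trans (cnormD _ _) _.
  have [_ /(_ L)] := kbdd_hnorm (x q - x p); rewrite -[kval (x q - x p)]/(kval (x q) - kval (x p)).
  have : hnorm (x q - x p) * lnorm psi L <= e * lnorm psi L by rewrite ler_wpM2r ?lnorm_ge0.
  lra.
have fH : f \in in_ksgns psi.
  have [N /(_ N (leqnn N)) fN] := f_lim 1 ltr01.
  apply/in_ksgnsP => e e_gt0; have e2 : 0 < e / 2 by rewrite divr_gt0.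
  have [M /(_ M (leqnn M)) fM] := f_lim _ e2; have [L LP] := ksgns_approx (x M) e2.
  exists L; rewrite -[f - _](subrKA (kval (x M))).
  by apply: kbdd_le (kbddD fM LP); lra.
exists (KSGNS hF hpsi fH) => e e_gt0; have e2 : 0 < e / 2 by rewrite divr_gt0.
have [N NP] := f_lim _ e2; exists N => p Np; apply: (@le_lt_trans _ _ (e / 2)); last by lra.
exact/hnorm_kbdd/kbdd_distC/NP.
Qed.

Lemma ksgns_hilbert : hilbert H.
Proof.
split; [exact: ksgns_pos | move=> u uu0 | exact: ksgns_complete].
apply: ksgns_eq => d; apply: (hnorm_eq0 hF); apply/eqP; rewrite eq_le hnorm_ge0 andbT.
have [C _ /(_ u)] := ksgns_eval_le d.
by rewrite [X in C * X]/hnorm /form_norm uu0 cnorm0 sqrtr0 mulr0.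
Qed.

Fact in_ksgns_lact a u : (fun d => u (star a * d)) \in in_ksgns psi.
Proof.
apply/in_ksgnsP => e e_gt0; have a0 := cnorm_ge0 a.
have [|L LP] := ksgns_approx u (e := e / (cnorm a + 1)); first by rewrite divr_gt0 //; lra.
exists (llact a L); rewrite kfun_lact.
apply: kbdd_le (kbdd_lact hF hpsi a LP).
by rewrite mulrA ler_pdivrMr 1?mulrC ?ler_wpM2l ?ltW //; lra.
Qed.

(** In the model [u d = V^* pi(d)^* u] this is the identity [pi(d)^* pi(a) = pi(a^* d)^*]. *)
Definition ksgns_lact a u : H := KSGNS hF hpsi (in_ksgns_lact a u).

Fact ksgns_lact_adj a u v :
  rin (ksgns_lact a u) v = rin u (ksgns_lact (star a) v) :> B.
Proof.
have [s vs] := ksgns_kbdd v; have s0 : 0 <= s by case: vs.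
apply/esym/(@ksgns_rin_eq _ _ _ (cnorm a * s)) => [|L e e_gt0 LP].
  by rewrite mulr_ge0 ?cnorm_ge0.
have -> : pairing L (ksgns_lact (star a) v) = pairing (llact a L) v.
  by rewrite pairing_lact; apply: eq_bigr => p _; rewrite /= starK.
rewrite mulrAC; apply: ksgns_rinP vs; rewrite kfun_lact.
exact: (kbdd_lact hF hpsi a LP).
Qed.

Definition ksgns_pi a : adjmap H H :=
  mk_adjmap ksgns_hilbert ksgns_hilbert (ksgns_lact_adj a).

(** The kernel function at the unit; by the reproducing property its adjoint is evaluation at 1. *)
Definition ksgns_incl (x : F) : H := kelt [:: (1, x)].

Fact ksgns_incl_adj x u : rin (ksgns_incl x) u = rin x (u 1) :> B.
Proof. by rewrite -[LHS]/(ksgns_rin _ _) ksgns_rin_kelt /pairing big_seq1. Qed.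

Definition ksgns_V : adjmap F H := mk_adjmap hF ksgns_hilbert ksgns_incl_adj.

Lemma ksgns_pi_V a x : ksgns_pi a (ksgns_V x) = kelt [:: (a, x)].
Proof.
apply: ksgns_eq => d; rewrite /= /kfun !big_seq1 /=.
by rewrite mulr1 starM starK.
Qed.

Lemma ksgns_eval d x u : rin x (u d) = rin (kelt [:: (d, x)]) u :> B.
Proof. by rewrite -[RHS]/(ksgns_rin _ _) ksgns_rin_kelt /pairing big_seq1. Qed.

Lemma kelt1D k a d x : kelt [:: (cscale k a + d, x)] = k *: kelt [:: (a, x)] + kelt [:: (d, x)].
Proof.
apply: ksgns_eq => c; rewrite -[RHS]/(k *: kfun _ _ _ + kfun _ _ _) /= /kfun !big_seq1 /=.
have -> : star c * (cscale k a + d) = cscale k (star c * a) + star c * d.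
  by rewrite mulrDr /cscale mulrA -cunitC mulrA.
by rewrite psiD // psiZ.
Qed.

Lemma ksgns_dense u (e : R) : 0 < e -> exists L, hnorm (u - kelt L) <= e.
Proof. by move=> /(ksgns_approx u) [L LP]; exists L; exact: hnorm_kbdd. Qed.

Lemma kelt_sum L : kelt L = \sum_(p <- L) ksgns_pi p.1 (ksgns_V p.2).
Proof.
elim: L => [|p L IH]; first by rewrite big_nil; apply: ksgns_eq => d; rewrite /= kfun_nil.
rewrite big_cons -IH ksgns_pi_V -surjective_pairing; apply: ksgns_eq => d.
by rewrite /= -cat1s kfun_cat.
Qed.

(** [pi] acts by [u (star a * d)], so linearity in [a] needs [u] conjugate-linear. The reproducing
    property moves the claim to the kernel functions, where it is linearity of [psi]. *)
Lemma ksgns_antilinear k a d u : u (cscale k a + d) = Num.conj k *: u a + u d.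
Proof.
have [_ F_def _] := hF; apply/eqP; rewrite -subr_eq0; set z := _ - _; apply/eqP/F_def.
rewrite {2}/z rinDr rinNr rinDr rinZr !ksgns_eval kelt1D rinDl rinZl.
exact: subrr.
Qed.

End KSGNSModule.

Lemma nondegenerate_unital (R : realType) (B A : cstarAlgType R) (E : innerModType B)
    (pi : A -> adjmap E E) : pi 1 = 1 ->
  dense_span *:%R (@hnorm R B E) [set pi p.1 p.2 | p in [set: A * E]]%classic.
Proof.
move=> pi1 x e e_gt0; exists 1%N, (fun=> 1), (fun=> x); split.
  by move=> _; exists (1, x) => //; rewrite pi1.
by rewrite big_ord1 scale1r subrr hnorm0.
Qed.

Lemma minimal_KSGNS_exists (R : realType) (B D : cstarAlgType R) (F : innerModType B)
    (psi : D -> adjmap F F) : hilbert F -> cp_map psi ->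
  exists (H : innerModType B) (pi : D -> adjmap H H) (V : adjmap F H),
    minimal_KSGNS psi pi V.
Proof.
move=> hF hpsi; exists (ksgns hF hpsi), (@ksgns_pi _ _ _ _ _ hF hpsi), (ksgns_V hF hpsi).
have hH := ksgns_hilbert hF hpsi.
have minimal : dense_span *:%R (@hnorm R B (ksgns hF hpsi))
    [set ksgns_pi hF hpsi p.1 (ksgns_V hF hpsi p.2) | p in [set: D * F]]%classic.
  move=> u e e_gt0; have [L LP] : exists L, hnorm (u - kelt hF hpsi L) <= e / 2.
    by apply: ksgns_dense; rewrite divr_gt0.
  exists (size L), (fun=> 1), (fun i => let p := tnth (in_tuple L) i in
    ksgns_pi hF hpsi p.1 (ksgns_V hF hpsi p.2)); split.
    by move=> i; exists (tnth (in_tuple L) i).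
  under eq_bigr do rewrite scale1r.
  rewrite -(big_tnth _ _ L xpredT (fun p => ksgns_pi hF hpsi p.1 (ksgns_V hF hpsi p.2))).
  by rewrite -kelt_sum; lra.
split=> //.
- split=> //.
  + move=> a; exists (cnorm a) => u; apply: hnorm_kbdd.
    exact/kbdd_lact/kbdd_hnorm.
  + move=> k a b; apply: adjmap_eq => // u; apply: ksgns_eq => d.
    have -> : (k *: ksgns_pi hF hpsi a + ksgns_pi hF hpsi b) u =
        k *: ksgns_pi hF hpsi a u + ksgns_pi hF hpsi b u by [].
    rewrite /= starD starZ mulrDl cscaleAl ksgns_antilinear conjCK.
    by [].
  + move=> a b; apply: adjmap_eq => // u; apply: ksgns_eq => d.
    by rewrite /= starM mulrA.
  + by move=> a; apply: adjmap_eq.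
  + apply: nondegenerate_unital; apply: adjmap_eq => // u; apply: ksgns_eq => d.
    by rewrite /= star1 mul1r.
(* [V] is bounded because its adjoint, evaluation at 1, is. *)
- apply: (bounded_star (T := adjmap_star (ksgns_V hF hpsi)) hF).
  by have [C _ CP] := ksgns_eval_le hF hpsi 1; exists C.
- move=> a; apply: adjmap_eq => // x.
  rewrite -[RHS]/(kfun psi [:: (1, x)] (star a * 1)) /kfun big_seq1 /=.
  by rewrite !mulr1 starK.
Qed.

(** * Equivalence bimodules *)

Section EquivalenceBimodules.
Variables (R : realType) (C D : cstarAlgType R) (Y : equivBimodType C D).
Implicit Types (x y z : Y) (c : C) (d : D).

Lemma linDr x y z : lin x (y + z) = lin x y + lin x z :> C.
Proof. by rewrite -linC linDl starD !linC. Qed.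
Lemma linNl x y : lin (- x) y = - lin x y :> C.
Proof. by rewrite -scaleN1r linZl cscaleN1. Qed.
Lemma linNr x y : lin x (- y) = - lin x y :> C.
Proof. by rewrite -linC linNl starN linC. Qed.
Lemma lin_lactr c x y : lin x (lact c y) = lin x y * star c :> C.
Proof. by rewrite -linC linA starM linC. Qed.

Lemma lact_sum I (s : seq I) (f : I -> C) y :
  lact (\sum_(i <- s) f i) y = \sum_(i <- s) lact (f i) y.
Proof.
apply: (big_morph (fun c : C => lact c y)) => [a b|]; first exact: lactDl.
by have := lactZl 0 (0 : C) y; rewrite cscale0 scale0r.
Qed.
Lemma lact_sumr I (s : seq I) c (f : I -> Y) :
  lact c (\sum_(i <- s) f i) = \sum_(i <- s) lact c (f i).
Proof.
apply: (big_morph (lact c)) => [a b|]; first exact: lactDr.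
by have := lactZr 0 c (0 : Y); rewrite !scale0r.
Qed.

Definition right_basis m (v : 'I_m -> Y) : Prop :=
  forall y, y = \sum_q ract (v q) (rin (v q) y : D).

(* Fullness gives a sum of [lin (x i) (y i)] close to 1, and polarization bounds its
   real part by the sum [T] of squares [lin w w]; rescale the [w] by [T^(-1/2)]. *)
Lemma right_basis_exists : exists m (v : 'I_m -> Y), right_basis v.
Proof.
(* Within 1/2 of the unit, [(1 - t) + star (1 - t)] has norm at most 1, which gives
   [t + star t >= 1]. *)
have h0 : 0 < 2^-1 :> R by rewrite invr_gt0.
have [m [k [s [sP small]]]] := (lin_full : full_form (lin : Y -> Y -> C)) 1 _ h0.
have /choice [p pP] i : exists p : Y * Y, lin p.1 p.2 = s i.
  by have [p _ <-] := sP i; exists p.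
pose x i := k i *: (p i).1; pose y i := (p i).2.
pose t : C := \sum_i lin (x i) (y i).
have {}small : cnorm (1 - t) <= 2^-1.
  apply: ltW; suff -> : t = \sum_i cscale (k i) (s i) by [].
  by apply: eq_bigr => i _; rewrite linZl pP.
pose T : C := \sum_i (lin (x i) (x i) + lin (y i) (y i)).
have lin_pos z : positive (lin z z : C) by case: (lin_hilbert : hilbert_form (lin : Y -> Y -> C)).
have T_ge1 : positive (T - 1).
  have tt1 : positive (t + star t - 1).
    have -> : t + star t - 1 = creal C 1 - ((1 - t) + star (1 - t)).
      by rewrite creal1 starB star1 opprD !opprB addrA [1 + _]addrC subrK addrA.
    apply: positive_subnorm; first by rewrite starD starK addrC.
    by apply: le_trans (cnormD _ _) _; rewrite cnormS; lra.
  have Tt : positive (T - (t + star t)).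
    rewrite /T /t star_sum -big_split -sumrB; apply: positive_sum => i _ /=.
    have := lin_pos (x i - y i); congr positive.
    rewrite linDl !linDr !linNl !linNr opprK [- _ + _]addrC addrACA -opprD.
    by rewrite linC.
  by rewrite -[_ - 1](subrKA (t + star t)); exact: positiveD.
have [h [hS hTh]] := inv_sqrt_ge1 T_ge1.
pose w (q : 'I_(m + m)) : Y := match fintype.split q with inl i => x i | inr i => y i end.
(* The unit [h T h] is the sum of the left inner squares of these vectors; acting on [z], each
   square [lin x x] sends it to [ract x (rin x z)]. *)
exists (m + m)%N, (fun q => lact h (w q)) => z; rewrite -[LHS]lact1 -hTh.
have -> : h * T * h = \sum_q lin (lact h (w q)) (lact h (w q)).
  rewrite big_split_ord /= mulr_sumr mulr_suml -big_split /=.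
  apply: eq_bigr => i _; rewrite /w (unsplitK (inl _ i)) (unsplitK (inr _ i)).
  by rewrite !linA !lin_lactr hS mulrDr mulrDl !mulrA.
by rewrite lact_sum; apply: eq_bigr => q _; rewrite lin_rin.
Qed.

Lemma rin_right_basis m (v : 'I_m -> Y) : right_basis v ->
  forall x y, rin x y = \sum_q rin x (v q) * rin (v q) y :> D.
Proof.
by move=> hv x y; rewrite {1}(hv y) rin_sumr; apply: eq_bigr => q _; rewrite rinA.
Qed.
End EquivalenceBimodules.

(** * Complete positivity of [phi] *)

Section CompressedMap.
Variables (R : realType) (B C D : cstarAlgType R) (Y : equivBimodType C D).
Variables (n : nat) (u : 'I_n -> Y) (F : innerModType B) (psi : D -> adjmap F F).
Hypotheses (hF : hilbert F) (hpsi : cp_map psi).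

Let phi (c : C) : adjmap {ffun 'I_n -> F} {ffun 'I_n -> F} :=
  adjmap_of_mx (\matrix_(i, j) psi (rin (u i) (lact c (u j)))).

Lemma compressed_bounded c : bounded_map (phi c).
Proof.
by apply: bounded_adjmap_of_mx => // i j; rewrite mxE; exact: cp_bounded.
Qed.

Lemma compressed_linear : clinear phi.
Proof.
move=> k a b; apply: adjmap_eq => [|x]; first exact: hilbert_dsum.
apply/ffunP => i; rewrite -[(k *: phi a + phi b) x]/(k *: phi a x + phi b x).
rewrite !ffunE scaler_sumr -big_split; apply: eq_bigr => j _; rewrite !mxE /=.
by rewrite lactDl lactZl rinDr rinZr (cp_linear hpsi).
Qed.

(* For [a = e^* e], the matrix of the [<u_k, a_ij u_l>] is the sum over [p] and [q] of
   the Gram matrices of the rows [<v_q, e_pi u_k>], as [v] is a right basis. *)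
Lemma compressed_positive m (a : 'M[C]_m) : positive a -> positive (map_mx phi a).
Proof.
case=> e ->; have [k [v hv]] := right_basis_exists Y.
pose d (p : 'I_m * 'I_k) : 'I_(m * n) -> D :=
  mxvec (\matrix_(i, l) rin (v p.2) (lact (e p.1 i) (u l))) 0.
have dE p i l : d p (mxvec_index i l) = rin (v p.2) (lact (e p.1 i) (u l)).
  by rewrite /d mxvecE mxE.
pose T p : 'M[adjmap F F]_(m * n) := \matrix_(r, s) psi (star (d p r) * d p s).
have -> : map_mx phi (star e * e) = \sum_p mxblocks (T p).
  apply/matrixP => i j; rewrite mxE summxE.
  under eq_bigr do rewrite mxE.
  rewrite -adjmap_of_mx_sum // /phi; congr adjmap_of_mx; apply/matrixP => r s.
  rewrite mxE summxE; under [RHS]eq_bigr do rewrite !mxE !dE.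
  rewrite mxE lact_sum rin_sumr (big_morph psi (psiD hpsi) (psi0 hpsi)).
  rewrite -(pair_bigA _ (fun p q => psi (star (rin (v q) (lact (e p i) (u r))) *
     rin (v q) (lact (e p j) (u s))))) /=.
  apply: eq_bigr => p _; rewrite mxE lactA -[star (e p i)]starK starK -rin_lact.
  rewrite (rin_right_basis hv) (big_morph psi (psiD hpsi) (psi0 hpsi)).
  by apply: eq_bigr => q _; rewrite rinC.
apply: positive_opmx_sum => [|p|p i j]; first exact: hilbert_dsum.
  by apply: positive_mxblocks => //; exact: psi_gram.
rewrite mxE; apply: bounded_adjmap_of_mx => // r s; rewrite !mxE; exact: cp_bounded.
Qed.

Lemma compressed_cp : cp_map phi.
Proof.
by split; [exact: compressed_bounded | exact: compressed_linear | exact: compressed_positive].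
Qed.
End CompressedMap.

(** * The induced representation *)

Section FixedSubmodule.
Variables (R : realType) (B : cstarAlgType R) (G : innerModType B) (T : adjmap G G).

(** For a projection the fixed points are its range; as an equation between continuous maps, the
    condition survives limits. *)
Definition is_fixed : {pred G} := fun x => `[< T x = x >].
Record fixmod := FixMod { fixval :> G; fixvalP : fixval \in is_fixed }.

Lemma is_fixedP x : reflect (T x = x) (x \in is_fixed).
Proof. exact: asboolP. Qed.

Fact is_fixed_submod : submod_closed is_fixed.
Proof.
split=> [|k x y /is_fixedP xP /is_fixedP yP]; apply/is_fixedP; first exact: linear0.
by have [-> _] := adjmap_mod T; rewrite xP yP.
Qed.

HB.instance Definition _ := [isSub for fixval].
HB.instance Definition _ := [Choice of fixmod by <:].
HB.instance Definition _ :=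
  GRing.SubChoice_isSubLmodule.Build _ _ _ fixmod is_fixed_submod.
Implicit Types (x y z : fixmod) (b c : B) (k : R[i]).

Fact fix_ract_proof x b : ract (fixval x) b \in is_fixed.
Proof.
apply/is_fixedP; have [_ ->] := adjmap_mod T.
by rewrite (is_fixedP _ (fixvalP x)).
Qed.
Definition fix_ract x b := FixMod (fix_ract_proof x b).
Definition fix_rin x y : B := rin (fixval x) (fixval y).

Fact fix_ractDl x y b : fix_ract (x + y) b = fix_ract x b + fix_ract y b.
Proof. by apply: val_inj; exact: ractDl. Qed.
Fact fix_ractDr x b c : fix_ract x (b + c) = fix_ract x b + fix_ract x c.
Proof. by apply: val_inj; exact: ractDr. Qed.
Fact fix_ractZl k x b : fix_ract (k *: x) b = k *: fix_ract x b.
Proof. by apply: val_inj; exact: ractZl. Qed.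
Fact fix_ractZr k x b : fix_ract x (cscale k b) = k *: fix_ract x b.
Proof. by apply: val_inj; exact: ractZr. Qed.
Fact fix_ractA x b c : fix_ract x (b * c) = fix_ract (fix_ract x b) c.
Proof. by apply: val_inj; exact: ractA. Qed.
Fact fix_ract1 x : fix_ract x 1 = x.
Proof. by apply: val_inj; exact: ract1. Qed.
Fact fix_rinDr x y z : fix_rin x (y + z) = fix_rin x y + fix_rin x z.
Proof. exact: rinDr. Qed.
Fact fix_rinZr k x y : fix_rin x (k *: y) = cscale k (fix_rin x y).
Proof. exact: rinZr. Qed.
Fact fix_rinA x y b : fix_rin x (fix_ract y b) = fix_rin x y * b.
Proof. exact: rinA. Qed.
Fact fix_rinC x y : star (fix_rin x y) = fix_rin y x.
Proof. exact: rinC. Qed.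

HB.instance Definition _ := isInnerModule.Build R B fixmod
  fix_ractDl fix_ractDr fix_ractZl fix_ractZr fix_ractA fix_ract1
  fix_rinDr fix_rinZr fix_rinA fix_rinC.

Lemma hilbert_fixmod : hilbert G -> bounded_map T -> hilbert fixmod.
Proof.
move=> hG /bounded_ge0 [M M0 MP]; have [G_pos G_def G_complete] := hG.
split=> [x|x xx0|x x_cauchy]; first exact: G_pos.
  exact/val_inj/G_def.
have [l lP] : exists l : G, forall e : R, 0 < e -> exists N, forall p,
    (N <= p)%N -> hnorm (fixval (x p) - l) < e by exact: G_complete.
have l_fixed : l \in is_fixed.
  apply/is_fixedP; apply: (eq_of_small_hnorm hG (M := M + 1)) => [|e e_gt0].
    by rewrite addr_ge0.
  have [N /(_ N (leqnn N)) lt_e] := lP _ e_gt0.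
  apply: le_trans (hdist_tri (hilbert_pos hG) (fixval (x N)) _ _) _.
  rewrite -{1}(is_fixedP _ (fixvalP (x N))) -linearB mulrDl mul1r; apply: lerD; last exact: ltW.
  by apply: le_trans (MP _) _; rewrite hdistC; apply: ler_wpM2l => //; exact: ltW.
by exists (FixMod l_fixed).
Qed.
End FixedSubmodule.

(* Given [rho : Y -> B_B(H, E)] compatible with a representation [pi] of [D] and with
   ranges that together span [E], [E] carries the representation of [C] induced from [pi]. *)
Section InducedRepresentation.
Variables (R : realType) (B C D : cstarAlgType R) (Y : equivBimodType C D).
Variables (H E : innerModType B) (pi : D -> adjmap H H) (rho : Y -> adjmap H E).
Variables (m : nat) (v : 'I_m -> Y).
Hypotheses (hv : right_basis v) (hE : hilbert E) (hpi : representation pi).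
Hypothesis rho_linear : linear rho.
Hypothesis rho_ract : forall y d h, rho (ract y d) h = rho y (pi d h).
Hypothesis rho_rin : forall y z h, adjmap_adj (rho y) (rho z h) = pi (rin y z) h.
Hypothesis rho_total : forall x, x = \sum_q rho (v q) (adjmap_adj (rho (v q)) x).
Implicit Types (x : E) (h : H) (y z : Y) (c : C) (d : D).

Let hH : hilbert H := rep_hilbert hpi.

Lemma rho_bounded y : bounded_map (rho y).
Proof.
have [M M0 MP] := bounded_ge0 (rep_bounded hpi (rin y y)).
exists (Num.sqrt M) => h.
rewrite -ler_sqr ?nnegrE ?mulr_ge0 ?sqrtr_ge0 ?hnorm_ge0 // exprMn (sqr_sqrtr M0).
rewrite [leLHS]hnorm_sqr adjmapE rho_rin.
apply: le_trans (cnorm_rin_le (hilbert_pos hH) _ _) _.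
by rewrite [leLHS]mulrC [_ ^+ 2]expr2 mulrA ler_wpM2r ?hnorm_ge0.
Qed.

Lemma rhoD y z h : rho (y + z) h = rho y h + rho z h.
Proof. by have := rho_linear 1 y z; rewrite !scale1r => ->. Qed.
Lemma rho0 h : rho 0 h = 0.
Proof. by apply: (addrI (rho 0 h)); rewrite -rhoD !addr0. Qed.
Lemma rho_sum I (s : seq I) (f : I -> Y) h :
  rho (\sum_(i <- s) f i) h = \sum_(i <- s) rho (f i) h.
Proof. exact: (big_morph (fun y => rho y h) (fun y z => rhoD y z h) (rho0 h)). Qed.

Lemma adjmap_eq_rho G (S T : adjmap E G) :
  (forall y h, S (rho y h) = T (rho y h)) -> S = T.
Proof.
move=> ST; apply: adjmap_eq => // x; rewrite [x]rho_total !linear_sum.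
by apply: eq_bigr => q _; exact: ST.
Qed.

(** The action must send [rho y h] to [rho (lact c y) h]; this formula is what the expansion
    [rho_total] then dictates, and it is visibly adjointable. *)
Definition induced c : adjmap E E :=
  \sum_q adjmap_comp (rho (lact c (v q))) (adjmap_star (rho (v q))).

Lemma induced_rho c y h : induced c (rho y h) = rho (lact c y) h.
Proof.
rewrite adjmap_sumE [in RHS](hv y) lact_sumr rho_sum.
by apply: eq_bigr => q _; rewrite -lact_ract rho_ract /= rho_rin.
Qed.

Lemma rho_rin_eq x x' : (forall y h, rin (rho y h) x = rin (rho y h) x' :> B) -> x = x'.
Proof.
move=> xx'; have [_ E_def _] := hE; apply/eqP; rewrite -subr_eq0.
apply/eqP/E_def; rewrite {1}[x - x']rho_total rin_suml big1 // => q _.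
by rewrite rinDr rinNr xx' subrr.
Qed.

Lemma induced_star c : induced (star c) = star (induced c).
Proof.
apply: adjmap_eq_rho => y h; apply: rho_rin_eq => z h'.
rewrite -[star (induced c) _]/(adjmap_adj (induced c) _) -adjmapE !induced_rho.
by rewrite !adjmapE !rho_rin rin_lact.
Qed.

Lemma induced_rep : representation induced.
Proof.
split=> //.
- move=> c; apply: bounded_sum => // q; apply: bounded_comp; first exact: rho_bounded.
  exact/bounded_star/rho_bounded.
- move=> k a b; apply: adjmap_eq_rho => y h.
  rewrite -[RHS]/(k *: induced a _ + induced b _) !induced_rho lactDl lactZl.
  by rewrite rho_linear.
- move=> a b; apply: adjmap_eq_rho => y h.
  by rewrite -[RHS]/(induced a (induced b _)) !induced_rho lactA.
- exact: induced_star.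
- apply: nondegenerate_unital; apply: adjmap_eq_rho => y h.
  by rewrite induced_rho lact1.
Qed.

Lemma induced_morita : rep_morita_equiv induced pi.
Proof.
exists Y, rho; split=> //.
- exact: rho_bounded.
(* On [rho w h] both sides give [rho (lact (lin y z) w) h], because
   [lact (lin y z) w = ract y (rin z w)]. *)
- move=> y z; apply: adjmap_eq_rho => w h.
  by rewrite /= rho_rin induced_rho lin_rin rho_ract.
- by move=> y z; apply: adjmap_eq => // h; exact: rho_rin.
- by move=> c y d; apply: adjmap_eq => // h; rewrite /= lact_ract -induced_rho rho_ract.
Qed.

End InducedRepresentation.

(** * The interior tensor product in coordinates *)

Section InteriorTensor.
Variables (R : realType) (B C D : cstarAlgType R) (Y : equivBimodType C D).
Variables (H : innerModType B) (pi : D -> adjmap H H) (hpi : representation pi).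
Variables (m : nat) (v : 'I_m -> Y) (hv : right_basis v).
Implicit Types (h : H) (y z : Y) (d : D).

Let hH : hilbert H := rep_hilbert hpi.

Lemma repD a d : pi (a + d) = pi a + pi d.
Proof. by have := rep_linear hpi 1 a d; rewrite /cscale rmorph1 mul1r scale1r. Qed.
Lemma rep0 : pi 0 = 0.
Proof. by apply: (addrI (pi 0)); rewrite -repD !addr0. Qed.
Lemma rep_sum I (s : seq I) (f : I -> D) : pi (\sum_(i <- s) f i) = \sum_(i <- s) pi (f i).
Proof. exact: (big_morph pi repD rep0). Qed.

(* The interior tensor product of [Y] and [H], realized in the direct sum of [m]
   copies of [H] as the range of the projection [[pi <v_i, v_j>]]. *)
Definition tensor_proj : adjmap {ffun 'I_m -> H} {ffun 'I_m -> H} :=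
  adjmap_of_mx (\matrix_(i, j) pi (rin (v i) (v j))).
Local Notation E := (fixmod tensor_proj).

Lemma tensor_hilbert : hilbert E.
Proof.
apply: hilbert_fixmod; first exact: hilbert_dsum.
by apply: bounded_adjmap_of_mx => // i j; rewrite mxE; exact: (rep_bounded hpi).
Qed.

Fact tensor_fixed y h : [ffun q => pi (rin (v q) y) h] \in is_fixed tensor_proj.
Proof.
apply/is_fixedP/ffunP => i; rewrite !ffunE (rin_right_basis hv) rep_sum adjmap_sumE.
by apply: eq_bigr => j _; rewrite mxE ffunE (repM hpi).
Qed.
(** The elementary tensor of [y] and [h]: expanding [y] in the right basis and moving coefficients
    across gives the sum of the [v_q] tensored with [pi(<v_q, y>) h]. *)
Definition tensor y h : E := FixMod (tensor_fixed y h).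
Definition tensor_adj y (x : E) : H := \sum_q pi (rin y (v q)) (fixval x q).

Fact tensor_adjoint y h (x : E) : rin (tensor y h) x = rin h (tensor_adj y x) :> B.
Proof.
rewrite /tensor_adj rin_sumr; apply: eq_bigr => q _; rewrite ffunE adjmapE.
by rewrite -[rin y _]rinC (rep_star hpi).
Qed.

Definition tensor_map y : adjmap H E := mk_adjmap hH tensor_hilbert (tensor_adjoint y).

Lemma tensor_linear : linear tensor_map.
Proof.
move=> k y z; apply: adjmap_eq => // h.
rewrite -[RHS]/(k *: tensor y h + tensor z h); apply: val_inj.
rewrite -[RHS]/(k *: fixval (tensor y h) + fixval (tensor z h)).
by apply/ffunP => q; rewrite !ffunE rinDr rinZr (rep_linear hpi).
Qed.

Lemma tensor_ract y d h : tensor_map (ract y d) h = tensor_map y (pi d h).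
Proof. by apply/val_inj/ffunP => q; rewrite !ffunE rinA (repM hpi). Qed.

Lemma tensor_rin y z h : adjmap_adj (tensor_map y) (tensor_map z h) = pi (rin y z) h.
Proof.
rewrite (rin_right_basis hv y z) rep_sum adjmap_sumE.
by apply: eq_bigr => q _; rewrite ffunE (repM hpi).
Qed.

(** The adjoint of [tensor_map (v q)] reads off the coordinate [x q] of a fixed vector, and the
    expansion is the fixed point equation itself. *)
Lemma tensor_total (x : E) :
  x = \sum_q tensor_map (v q) (adjmap_adj (tensor_map (v q)) x).
Proof.
have xE q : adjmap_adj (tensor_map (v q)) x = fixval x q.
  by rewrite -[in RHS](is_fixedP _ _ (fixvalP x)) ffunE; apply: eq_bigr => r _; rewrite mxE.
apply: val_inj; rewrite [RHS]raddf_sum -[LHS](is_fixedP _ _ (fixvalP x)).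
apply/ffunP => i; rewrite sum_ffunE ffunE; apply: eq_bigr => q _.
by rewrite xE mxE ffunE.
Qed.
End InteriorTensor.

(** * Linear spans and density *)

Section LinearSpan.
Variables (R : realType) (B : cstarAlgType R) (E : innerModType B).
Hypothesis hE : hilbert E.
Implicit Types (S : set E) (x y : E) (k : R[i]).

Definition span S x : Prop := exists m (k : 'I_m -> R[i]) (s : 'I_m -> E),
  (forall i, S (s i)) /\ x = \sum_i k i *: s i.

(** A pointwise form of [dense_span], so that a vector can be split into summands and each
    approximated on its own. *)
Definition approx_span S x : Prop :=
  forall e : R, 0 < e -> exists2 y, span S y & hnorm (x - y) < e.

Lemma dense_span_approx S : dense_span *:%R (@hnorm R B E) S <-> forall x, approx_span S x.
Proof.
split=> dS x e /(dS x) => [[m [k [s [sS lt_e]]]]|[y [m [k [s [sS ->]]]] lt_e]].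
  by exists (\sum_i k i *: s i) => //; exists m, k, s.
by exists m, k, s.
Qed.

Lemma span_elt S x : S x -> span S x.
Proof. by exists 1%N, (fun=> 1), (fun=> x); rewrite big_ord1 scale1r. Qed.

Lemma span0 S : span S 0.
Proof. by exists 0%N, (fun=> 0), (fun=> 0); split=> [[]|]; rewrite ?big_ord0. Qed.

Lemma spanD S x y : span S x -> span S y -> span S (x + y).
Proof.
move=> [m [k [s [sS ->]]]] [p [l [t [tS ->]]]].
exists (m + p)%N, (fun i => match fintype.split i with inl i => k i | inr i => l i end),
  (fun i => match fintype.split i with inl i => s i | inr i => t i end); split.
  by move=> i; case: fintype.split.
rewrite big_split_ord /=; congr (_ + _); apply: eq_bigr => i _.
  by rewrite (unsplitK (inl _ i)).
by rewrite (unsplitK (inr _ i)).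
Qed.

Lemma spanZ S k x : span S x -> span S (k *: x).
Proof.
move=> [m [l [s [sS ->]]]]; exists m, (fun i => k * l i), s; split=> //.
by rewrite scaler_sumr; apply: eq_bigr => i _; rewrite scalerA.
Qed.

Lemma span_sum S I (r : seq I) (f : I -> E) :
  (forall i, span S (f i)) -> span S (\sum_(i <- r) f i).
Proof. by move=> fS; apply: big_ind => //; [exact: span0 | exact: spanD]. Qed.

Lemma approx_spanD S x y : approx_span S x -> approx_span S y -> approx_span S (x + y).
Proof.
move=> xS yS e e_gt0; have e2 : 0 < e / 2 by rewrite divr_gt0.
have [x' x'S lt_x] := xS _ e2; have [y' y'S lt_y] := yS _ e2.
exists (x' + y'); first exact: spanD.
rewrite opprD addrACA; apply: le_lt_trans (hnormD (hilbert_pos hE) _ _) _; lra.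
Qed.

Lemma approx_span_elt S x : span S x -> approx_span S x.
Proof. by move=> xS e e_gt0; exists x => //; rewrite subrr hnorm0. Qed.

Lemma approx_span_sum S I (r : seq I) (f : I -> E) :
  (forall i, approx_span S (f i)) -> approx_span S (\sum_(i <- r) f i).
Proof.
move=> fS; apply: big_ind => //; [exact/approx_span_elt/span0 | exact: approx_spanD].
Qed.
End LinearSpan.

Lemma approx_span_image (R : realType) (B : cstarAlgType R) (F E : innerModType B)
    (S : set F) (T : set E) (f : adjmap F E) x : bounded_map f ->
  (forall s, S s -> span T (f s)) -> approx_span S x -> approx_span T (f x).
Proof.
move=> /bounded_ge0 [M M0 MP] ST xS e e_gt0; have M1 : 0 < M + 1 by lra.
have [y [m [k [s [sS yE]]]] lt_e] := xS _ (divr_gt0 e_gt0 M1).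
exists (f y).
  by rewrite yE linear_sum; apply: span_sum => i; rewrite linearZ; apply/spanZ/ST.
rewrite -linearB; apply: le_lt_trans (MP _) _; move: lt_e; rewrite ltr_pdivlMr //.
by have := hnorm_ge0 (x - y); lra.
Qed.

Theorem theorem3p4 (R : realType) (B C D : cstarAlgType R)
    (Y : equivBimodType C D) (n : nat) (u : 'I_n -> Y) (hu : left_basis u)
    (F : innerModType B) (hF : hilbert F)
    (psi : D -> adjmap F F) (hpsi : cp_map psi) :
  let phi (c : C) : adjmap {ffun 'I_n -> F} {ffun 'I_n -> F} :=
    adjmap_of_mx (\matrix_(i, j) psi (rin (u i) (lact c (u j)))) in
  [/\ hilbert {ffun 'I_n -> F}, cp_map phi & cp_morita_equiv phi psi].
Proof.
move=> phi; have hFn := hilbert_dsum n hF.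
split=> //; first exact: compressed_cp.
have [H [pi [W HKSGNS]]] := minimal_KSGNS_exists hF hpsi.
have [hpi W_bdd psiE W_dense] := HKSGNS.
have [m [v hv]] := right_basis_exists Y.
pose E : innerModType B := fixmod (tensor_proj pi v).
have hE : hilbert E := tensor_hilbert hpi v.
pose rho : Y -> adjmap H E := tensor_map hpi hv.
have rho_lin : linear rho by exact: tensor_linear.
have rho_ract y d h : rho (ract y d) h = rho y (pi d h) by exact: tensor_ract.
have rho_rin y z h : adjmap_adj (rho y) (rho z h) = pi (rin y z) h by exact: tensor_rin.
have rho_total (x : E) : x = \sum_q rho (v q) (adjmap_adj (rho (v q)) x) by exact: tensor_total.
(* From here on, the tensor product is used only through these four properties of [rho] and the
   completeness of [E]. *)
clearbody rho; move: E hE rho rho_lin rho_ract rho_rin rho_total.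
move=> E hE rho rho_lin rho_ract rho_rin rho_total.
pose piC : C -> adjmap E E := induced rho v.
have piC_rho c y h : piC c (rho y h) = rho (lact c y) h by exact: induced_rho.
pose V : adjmap {ffun 'I_n -> F} E := \sum_j
  adjmap_comp (rho (u j)) (adjmap_comp W (adjmap_star (opinj hF j))).
have VE x : V x = \sum_j rho (u j) (W (x j)) by rewrite adjmap_sumE.
have V_bdd : bounded_map V.
  apply: bounded_sum => // j; apply: bounded_comp; first exact: (rho_bounded hpi).
  apply: bounded_comp => //; exists 1 => x; rewrite mul1r; exact: hnorm_proj_le.
exists E, piC, V, H, pi, W; split=> //; last exact: induced_morita.
split=> //.
- exact: (induced_rep hv hE hpi rho_lin rho_ract rho_rin rho_total).
(* The [(i, j)] entry of [V^* piC(c) V] is [W^* rho(u_i)^* rho(c u_j) W = W^* pi(<u_i, c u_j>) W],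
   which is the entry of [phi c] since [(pi, W)] represents [psi]. *)
- move=> c; apply: adjmap_eq => // x; apply/ffunP => i.
  have V_adj (y : E) : adjmap_adj V y i = adjmap_adj W (adjmap_adj (rho (u i)) y).
    rewrite adjmap_adj_sumE sum_ffunE (bigD1 i) //= ffunE eqxx big1 ?addr0 // => j.
    by rewrite eq_sym => /negPf ji; rewrite ffunE ji.
  have piCV : piC c (V x) = \sum_j rho (lact c (u j)) (W (x j)).
    by rewrite VE linear_sum; apply: eq_bigr => j _; exact: piC_rho.
  rewrite [RHS]V_adj -[adjmap_comp _ _ _]/(piC c (V x)) piCV ffunE.
  rewrite !linear_sum; apply: eq_bigr => j _; rewrite mxE psiE.
  exact: congr1 (esym (rho_rin _ _ _)).
(* It suffices to approximate each [rho (v q) h]. Density in [H] replaces [h] by vectors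
   [pi d (W z)], and moving [d] across [rho] leaves [rho y (W z)] with [y = ract (v q) d], which
   lies exactly in the span. *)
- apply/dense_span_approx => x; rewrite [x]rho_total.
  apply: approx_span_sum => // q.
  apply: approx_span_image (proj1 (dense_span_approx _) W_dense _).
    exact: (rho_bounded hpi).
  move=> _ [[d z] _ <-] /=; rewrite -rho_ract [ract _ _]hu (rho_sum rho_lin).
  apply: span_sum => i; apply: span_elt.
  exists (lin (ract (v q) d) (u i), opinj hF i z) => //=.
  rewrite VE (bigD1 i) //= ffunE eqxx big1 ?addr0 => [|j /negPf ji]; first exact: piC_rho.
  by rewrite ffunE ji !linear0.
Qed.
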